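(* Let $W^\varphi=[-1,1]^2$, let $\alpha>0$, and let $\Gamma=\bigcup_{i=1}^nS_i$ be a stationary polygonal curve. Unbounded case. Suppose $S_1$ and $S_n$ are half-lines. Then, up to translations, horizontal and vertical reflections and rotations by a multiple of $90^\circ$, $\Gamma$ is one of the following: (U1) a staircase: $n\ge2$ is any integer, the angles of $\Gamma$ alternate (e.g. $\theta_i=\pi/2$ for all even indices and $\theta_i=3\pi/2$ for all odd indices), and the segments have arbitrary positive lengths; (U2) a right-angle chain: a union of $m\ge1$ right-angles of sidelength $\sqrt{2\alpha}$, formed by $3m-1$ segments and two half-lines (i.e. $n=3m+1$); here $\mathcal{H}^1(S_{3i+2})=\mathcal{H}^1(S_{3i+3})=\sqrt{2\alpha}$ for all $0\le i\le m-1$, and the segments $S_{3i+1}$ with $0<i<m$ have arbitrary length and zero $\varphi$-curvature, i.e. $c_{3i+1}=0$; (U3) a double-right-angle chain: a union of $m\ge1$ double-right-angles, each consisting of two horizontal segments of lengths $a,b>0$ with $\frac1{a^2}+\frac1{b^2}=\frac1{2\alpha}$ and one vertical segment of length $\sqrt{2\alpha}$, formed by $4m-1$ segments and two half-lines (i.e. $n=4m+1$); here $\mathcal{H}^1(S_{4i+3})=\sqrt{2\alpha}$ for all $0\le i\le m-1$, $\mathcal{H}^1(S_{8i+2})=\mathcal{H}^1(S_{8i})=a$ and $\mathcal{H}^1(S_{8i+4})=\mathcal{H}^1(S_{8i+6})=b$ for all $i\ge 0$ for which these indices lie in $\{2,\dots,n-1\}$, and all segments $S_{4i+1}$ with $0<i<m$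 have arbitrary length and zero $\varphi$-curvature, i.e. $c_{4i+1}=0$. Closed case. Suppose $\Gamma$ is closed. Then, up to translations, horizontal and vertical reflections and rotations by a multiple of $90^\circ$, $\Gamma$ is one of the following: (C1) a right-angle chain: a union of $2m\ge2$ right-angles of sidelength $\sqrt{2\alpha}$, formed by $n=6m$ segments; here $\mathcal{H}^1(S_{3i+1})=\mathcal{H}^1(S_{3i+2})=\sqrt{2\alpha}$ for all $0\le i\le2m-1$, and the segments $S_{3i}$ with $1\le i\le2m$ have zero $\varphi$-curvature, i.e. $c_{3i}=0$. Moreover, if $m=1$, $\mathcal{H}^1(S_3)=\mathcal{H}^1(S_6)=2\sqrt{2\alpha}$, while if $m>1$, all zero $\varphi$-curvature segments $S_{3i}$ with $1\le i<2m$ can have arbitrary length and $S_{6m}$ is uniquely defined; (C2) a double-right-angle chain: a union of $2m\ge2$ double-right-angles, each consisting of two horizontal segments of length $\sqrt{4\alpha}$ and one vertical segment of length $\sqrt{2\alpha}$, formed by $n=8m$ segments; here $\mathcal{H}^1(S_{2i})=\sqrt{4\alpha}$ for all $1\le i\le4m$, $\mathcal{H}^1(S_{4i+3})=\sqrt{2\alpha}$ for all $0\le i<2m$, and all segments $S_{4i+1}$ with $0\le i<2m$ have zero $\varphi$-curvature, i.e. $c_{4i+1}=0$. Moreover, $\Gamma$ lies in the strip $[-\sqrt{4\alpha},\sqrt{4\alpha}]\times\mathbb{R}$ and all vertical segments with transition number $c\in\{-1,0,1\}$ are located on the vertical line $\{c\sqrt{4\alpha}\}\times\mathbb{R}$.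 In particular, $m$ double-right-angles are contained in $[-\sqrt{4\alpha},0]\times\mathbb{R}$, while the remaining $m$ are contained in $[0,\sqrt{4\alpha}]\times\mathbb{R}$; (C3) a square of sidelength $\sqrt{4\alpha}$, i.e. a Wulff shape of radius $\sqrt\alpha$.
   Context: Here $\varphi(x)=\max\{|x_1|,|x_2|\}$, so that the Wulff shape $W^\varphi=\{\varphi\le1\}$ is the square $[-1,1]^2$, whose four edges (facets) have length $2$ and outward normals $\pm e_1,\pm e_2$; the dual norm is $\varphi^o(x)=|x_1|+|x_2|$. A Wulff shape of radius $r$ is a translate of $rW^\varphi$. $\mathcal{H}^1$ is length. Polygonal curves. All curves are oriented and may self-intersect. A closed polygonal curve is a closed consecutive union $\Gamma=\bigcup_{i=1}^nS_i$ of finitely many segments of positive length, indices being cyclic ($S_0=S_n$, $S_{n+1}=S_1$, etc.). An unbounded polygonal curve is a consecutive union $\bigcup_{i=1}^nS_i$ with $S_1,S_n$ half-lines and $S_2,\dots,S_{n-1}$ bounded segments. $\nu_{S_i}$ is the unit tangent (in the direction of the parametrization) rotated counterclockwise by $90^\circ$. Curves are assumed admissible, which here means that each $\nu_{S_i}\in\{\pm e_1,\pm e_2\}$ and consecutive segments are orthogonal. The angle $\theta_i$ between $S_{i-1}$ and $S_i$ ($2\le i\le n$ in the unbounded case) is $\pi/2$ if $S_{i-1},S_i$ form a convex cone for which $\nu_{S_{i-1}},\nu_{S_i}$ are inner normals, and $3\pi/2$ otherwise (a convex polygon with outward normals has all angles $3\pi/2$). The transition number $c_i$ of $S_i$ is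 $+1$ if $\theta_i=\theta_{i+1}=3\pi/2$, $-1$ if $\theta_i=\theta_{i+1}=\pi/2$, and $0$ if $\theta_i\ne\theta_{i+1}$ or $S_i$ is a half-line. The $\varphi$-curvature of $S_i$ is $2c_i/\mathcal{H}^1(S_i)$ ($0$ for half-lines). Stationary. $\Gamma$ is stationary if for every (bounded) segment $S_i$ $$c_i+2\alpha\Big(\frac{c_{i-1}^2}{\mathcal{H}^1(S_{i-1})^2\sin\theta_i}+\frac{c_{i+1}^2}{\mathcal{H}^1(S_{i+1})^2\sin\theta_{i+1}}\Big)=0,$$ terms with $c_j=0$ being $0$. A right-angle is a pair of consecutive segments with nonzero transition numbers of the same sign preceded and followed by a segment/half-line with transition number $0$; a double-right-angle is, similarly, a triple of consecutive segments (horizontal, vertical, horizontal) with nonzero transition numbers of the same sign preceded and followed by a segment/half-line with transition number $0$. In chains, consecutive right-angles (resp. double-right-angles) are connected by one segment with transition number $0$ and have transition numbers of opposite sign.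
   Formalization: In (C1), m>1, the lengths of S_{3i}, 1≤i<2m, cannot be wholly arbitrary: closing up forces those with odd i to sum to 2m√(2α) and those with even i to sum to less than 2m√(2α). Existence of the chain and uniqueness of the length of S_{6m} are stated under exactly these conditions. *)

(* Defs.v *)
From HB Require Import structures.
From mathcomp Require Import all_boot all_order all_algebra.
From mathcomp Require Import all_classical all_reals topology normedtype trigo.

Set Implicit Arguments.
Unset Strict Implicit.
Unset Printing Implicit Defensive.

Import Order.TTheory GRing.Theory Num.Theory.
Import numFieldNormedType.Exports.

Local Open Scope classical_set_scope.
Local Open Scope ring_scope.

Section PlaneAndWulffShapes.
Variable R : realType.

Definition scale (s : R) (x : R * R) : R * R := (s * x.1, s * x.2).
Definition dot (x y : R * R) : R := x.1 * y.1 + x.2 * y.2.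
Definition enorm (x : R * R) : R := Num.sqrt (dot x x).
Definition e1 : R * R := (1, 0).
Definition e2 : R * R := (0, 1).
Definition rot90 (x : R * R) : R * R := (- x.2, x.1).

Definition phi (x : R * R) : R := Num.max `|x.1| `|x.2|.
Definition wulff : set (R * R) := [set x | phi x <= 1].
Definition wulff_shape (r : R) (z : R * R) : set (R * R) :=
  [set z + scale r w | w in wulff].
Definition boundary (A : set (R * R)) : set (R * R) := closure A `\` interior A.

(* The group generated by translations, horizontal and vertical reflections
   and rotations by multiples of 90 degrees. *)
Inductive motion : (R * R -> R * R) -> Prop :=
| motion_id : motion id
| motion_translation (v : R * R) : motion (fun x => x + v)
| motion_hreflection : motion (fun x => (- x.1, x.2))
| motion_vreflection : motion (fun x => (x.1, - x.2))
| motion_rot90 : motion rot90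
| motion_comp (f g : R * R -> R * R) :
    motion f -> motion g -> motion (f \o g).

End PlaneAndWulffShapes.

Arguments e1 {R}.
Arguments e2 {R}.

(* A polygonal curve S_1, ..., S_n is encoded by points (vtx i), i : int: the
   segment S_i goes from vtx i to vtx (i + 1).
   - Closed curve: vtx is n-periodic, so that S_0 = S_n, S_(n+1) = S_1, etc.
   - Unbounded curve: S_1 is the half-line ending at vtx 2 and coming from
     infinity through vtx 1, and S_n is the half-line starting at vtx n and
     going to infinity through vtx (n + 1). Thus vtx 1 and vtx (n + 1) only
     record directions, and the other points outside 1, ..., n + 1 are unused. *)
Record polycurve (R : realType) := PolyCurve {
  is_closed : bool;
  nseg : nat;
  vtx : int -> R * R }.

Section PolygonalCurves.
Variable R : realType.
Implicit Types (G : polycurve R) (alpha a b : R) (i j : int) (m : nat).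

Definition in_range G i : bool := 1 <= i <= (nseg G)%:Z.
Definition first_halfline G i : bool := ~~ is_closed G && (i == 1).
Definition last_halfline G i : bool := ~~ is_closed G && (i == (nseg G)%:Z).
Definition halfline G i : bool := first_halfline G i || last_halfline G i.

Definition edge G i : R * R := vtx G (i + 1) - vtx G i.

Definition segment G i : set (R * R) :=
  [set x | exists s : R,
     [/\ first_halfline G i \/ 0 <= s,
         last_halfline G i \/ s <= 1
       & x = vtx G i + scale s (edge G i)]].

Definition trace G : set (R * R) :=
  [set x | exists i, in_range G i /\ segment G i x].

(* The length of S_i; meaningful only when S_i is not a half-line. *)
Definition len G i : R := enorm (edge G i).

Definition tangent G i : R * R := scale (len G i)^-1 (edge G i).
Definition normal G i : R * R := rot90 (tangent G i).

Definition horizontal G i : Prop := (edge G i).2 = 0.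
Definition vertical G i : Prop := (edge G i).1 = 0.

Definition closed_curve G : Prop :=
  [/\ is_closed G,
      (0 < nseg G)%N,
      (forall i, vtx G (i + (nseg G)%:Z) = vtx G i)
    & forall i, in_range G i -> vtx G (i + 1) != vtx G i].

Definition unbounded_curve G : Prop :=
  [/\ ~~ is_closed G,
      (2 <= nseg G)%N
    & forall i, in_range G i -> vtx G (i + 1) != vtx G i].

(* There is an angle theta_i between S_(i-1) and S_i. *)
Definition corner G i : bool := in_range G i && (is_closed G || (2 <= i)).

Definition admissible G : Prop :=
  (forall i, in_range G i ->
     [\/ normal G i = e1, normal G i = - e1,
         normal G i = e2 | normal G i = - e2]) /\
  (forall i, corner G i -> dot (tangent G (i - 1)) (tangent G i) = 0).

(* The convex cone spanned by S_(i-1) and S_i, translated so that its apex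
   vtx i is the origin. *)
Definition cone G i : set (R * R) :=
  [set x | exists s t : R,
     [/\ 0 <= s, 0 <= t
       & x = scale s (- tangent G (i - 1)) + scale t (tangent G i)]].

Definition inner_normal (C : set (R * R)) (nu : R * R) : Prop :=
  forall x, C x -> 0 <= dot nu x.

Definition theta G i : R :=
  if `[< inner_normal (cone G i) (normal G (i - 1)) /\
         inner_normal (cone G i) (normal G i) >]
  then pi / 2 else 3 * pi / 2.

Definition transition G i : int :=
  if halfline G i then 0
  else if (theta G i == 3 * pi / 2) && (theta G (i + 1) == 3 * pi / 2) then 1
  else if (theta G i == pi / 2) && (theta G (i + 1) == pi / 2) then - 1
  else 0.

(* 2 is the length of the facets of the Wulff shape. *)
Definition phi_curvature G i : R :=
  if halfline G i then 0 else 2 * (transition G i)%:~R / len G i.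

(* Since x / 0 = 0, and 0 / x = 0 for the length of a half-line as well, the
   terms with zero transition number vanish. *)
Definition stationary alpha G : Prop :=
  forall i, in_range G i -> ~~ halfline G i ->
    (transition G i)%:~R
    + 2 * alpha
      * ((transition G (i - 1))%:~R ^+ 2
           / (len G (i - 1) ^+ 2 * sin (theta G i))
         + (transition G (i + 1))%:~R ^+ 2
           / (len G (i + 1) ^+ 2 * sin (theta G (i + 1)))) = 0.

Definition move (f : R * R -> R * R) G : polycurve R :=
  PolyCurve (is_closed G) (nseg G) (f \o vtx G).

(* Cyclic relabelling of the segments of a closed curve. *)
Definition relabel (k : int) G : polycurve R :=
  PolyCurve (is_closed G) (nseg G) (fun i => vtx G (i + k)).

(* The pair S_j, S_(j+1). *)
Definition right_angle G j : Prop :=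
  [/\ transition G (j - 1) = 0,
      0 < transition G j * transition G (j + 1)
    & transition G (j + 2) = 0].

(* The triple S_j, S_(j+1), S_(j+2). *)
Definition double_right_angle G j : Prop :=
  [/\ transition G (j - 1) = 0,
      0 < transition G j * transition G (j + 1),
      0 < transition G (j + 1) * transition G (j + 2),
      transition G (j + 3) = 0
    & [/\ horizontal G j, vertical G (j + 1) & horizontal G (j + 2)]].

Definition opposite_transition G i j : Prop :=
  transition G i * transition G j < 0.

Definition zero_curvature G i : Prop :=
  phi_curvature G i = 0 /\ transition G i = 0.

Definition staircase G : Prop :=
  (2 <= nseg G)%N /\
  forall i, 2 <= i < (nseg G)%:Z -> theta G i <> theta G (i + 1).

Definition right_angle_chain alpha m G : Prop :=
  [/\ nseg G = (3 * m + 1)%N,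
      (forall k : nat, (k < m)%N ->
         [/\ right_angle G (3 * k + 2)%N,
             len G (3 * k + 2)%N = Num.sqrt (2 * alpha)
           & len G (3 * k + 3)%N = Num.sqrt (2 * alpha)]),
      (forall k : nat, (k.+1 < m)%N ->
         opposite_transition G (3 * k + 2)%N (3 * k.+1 + 2)%N)
    & forall k : nat, (0 < k < m)%N -> zero_curvature G (3 * k + 1)%N].

Definition double_right_angle_chain alpha a b m G : Prop :=
  [/\ nseg G = (4 * m + 1)%N,
      (forall k : nat, (k < m)%N ->
         double_right_angle G (4 * k + 2)%N /\
         len G (4 * k + 3)%N = Num.sqrt (2 * alpha)),
      (forall k : nat, (k.+1 < m)%N ->
         opposite_transition G (4 * k + 2)%N (4 * k.+1 + 2)%N),
      (forall k : nat,
         [/\ (2 <= 8 * k + 2 < nseg G)%N -> len G (8 * k + 2)%N = a,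
             (2 <= 8 * k < nseg G)%N -> len G (8 * k)%N = a,
             (2 <= 8 * k + 4 < nseg G)%N -> len G (8 * k + 4)%N = b
           & (2 <= 8 * k + 6 < nseg G)%N -> len G (8 * k + 6)%N = b])
    & forall k : nat, (0 < k < m)%N -> zero_curvature G (4 * k + 1)%N].

Definition closed_right_angle_chain alpha m G : Prop :=
  [/\ nseg G = (6 * m)%N,
      (forall k : nat, (k < 2 * m)%N ->
         [/\ right_angle G (3 * k + 1)%N,
             len G (3 * k + 1)%N = Num.sqrt (2 * alpha)
           & len G (3 * k + 2)%N = Num.sqrt (2 * alpha)]),
      (forall k : nat, (k < 2 * m)%N ->
         opposite_transition G (3 * k + 1)%N (3 * k.+1 + 1)%N),
      (forall k : nat, (1 <= k <= 2 * m)%N -> zero_curvature G (3 * k)%N)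
    & m = 1%N -> len G 3 = 2 * Num.sqrt (2 * alpha) /\
                 len G 6 = 2 * Num.sqrt (2 * alpha)].

Definition in_vertical_strip (l r : R) : set (R * R) :=
  [set x | l <= x.1 <= r].

Definition double_right_angle_set G j : set (R * R) :=
  segment G j `|` segment G (j + 1) `|` segment G (j + 2).

Definition closed_double_right_angle_chain alpha m G : Prop :=
  let w := Num.sqrt (4 * alpha) in
  [/\ nseg G = (8 * m)%N,
      (forall k : nat, (k < 2 * m)%N ->
         [/\ double_right_angle G (4 * k + 2)%N,
             len G (4 * k + 3)%N = Num.sqrt (2 * alpha),
             opposite_transition G (4 * k + 2)%N (4 * k.+1 + 2)%N
           & zero_curvature G (4 * k + 1)%N]),
      (forall k : nat, (1 <= k <= 4 * m)%N -> len G (2 * k)%N = w),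
      trace G `<=` in_vertical_strip (- w) w /\
      (forall i, in_range G i -> vertical G i ->
         segment G i `<=` [set x | x.1 = (transition G i)%:~R * w])
    & exists A : {set 'I_(2 * m)},
        #|A| = m /\
        forall k : 'I_(2 * m),
          double_right_angle_set G (4 * k + 2)%N `<=`
            (if k \in A then in_vertical_strip (- w) 0
             else in_vertical_strip 0 w)].

(* A closed curve may run several times around the square. *)
Definition square alpha G : Prop :=
  (forall i, in_range G i -> len G i = Num.sqrt (4 * alpha)) /\
  exists z : R * R, trace G = boundary (wulff_shape (Num.sqrt alpha) z).

End PolygonalCurves.

(* Main.v *)
(* Put w_i = c_i^2 / H^1(S_i)^2 and K = 1 / (2 alpha). Since sin theta_i = 1 at
   left turns, sin theta_i = -1 at right turns, and c_i is determined by the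
   turns at both ends of S_i, stationarity at S_i reads w_(i-1) + w_(i+1) = K if
   w_i <> 0 and w_(i-1) = w_(i+1) if w_i = 0. This recurrence is deterministic.
   Started from w = 0 (a half-line, or a segment with zero transition number) and
   a next value A, its solution is 0, 0, 0, ... (staircase), 0, K, K repeated
   (right-angle chain) or 0, A, K, K - A, 0, K - A, K, A repeated
   (double-right-angle chain). An unbounded curve ends with w_n = 0, which gives
   the number of segments.
   On a closed curve the turns alternate between consecutive blocks, so that the
   number of blocks is even by periodicity. The curve has to close up: a staircase
   never does, and for the double-right-angle chains and for the curves without
   vanishing w_i the horizontal displacement over a period is a multiple of the
   difference of two lengths, which are therefore equal. If no w_i vanishes, all
   turns are in the same direction and the curve runs around a square. *)
Require Import Defs.
From HB Require Import structures.
From mathcomp Require Import all_boot all_order all_algebra.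
From mathcomp Require Import all_classical all_reals topology normedtype trigo.
From mathcomp Require Import ring lra zify.

Set Implicit Arguments.
Unset Strict Implicit.
Unset Printing Implicit Defensive.

Import Order.TTheory GRing.Theory Num.Theory.
Import numFieldNormedType.Exports.

Local Open Scope classical_set_scope.
Local Open Scope ring_scope.

(** * Turns, transition numbers and weights *)

(** The two chains belong to one family: after 0, A come K and K - A. If K - A vanishes, the block
    ends there and is a right-angle; otherwise it has one more segment and is a double-right-angle.
    So the weight two places after A decides between them. In a closed double-right-angle chain,
    passing to the next block reverses the horizontal direction and also exchanges the two
    horizontal lengths. The displacements of the blocks therefore add up instead of cancelling, and
    closing forces A = K / 2. In a closed right-angle chain the zero-curvature segments lie in two
    orthogonal directions. Closing is one linear condition in each direction; the last segment
    enters only one of them, so the other remains as a constraint on the free lengths. For the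
    existence statements a polyline is built from prescribed turns and lengths, and only its weights
    are computed. The classification lemmas then show that it is a chain, and the number of segments
    identifies m. *)

Section Turns.
Variable R : realType.
Implicit Types (G : polycurve R) (alpha K A : R) (i j : int) (x y : R * R).

(** [theta] takes only two values, so this boolean determines it. As normals are tangents rotated
    counterclockwise, the angle [pi / 2] is a turn to the left. *)
Definition left_turn G i : bool := theta G i == pi / 2.

Lemma pi_half_neq : (3 * pi / 2 == pi / 2 :> R) = false.
Proof. by apply/negbTE/eqP => h; have := pi_gt0 R; lra. Qed.

Lemma thetaE G i : theta G i = if left_turn G i then pi / 2 else 3 * pi / 2.
Proof.
by rewrite /left_turn /theta; case: ifP => _; rewrite ?eqxx ?pi_half_neq.
Qed.

Lemma left_turnP G i :
  left_turn G i = `[< inner_normal (cone G i) (normal G (i - 1)) /\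
                      inner_normal (cone G i) (normal G i) >].
Proof.
by rewrite /left_turn /theta; case: ifP => _; rewrite ?eqxx ?pi_half_neq.
Qed.

Lemma sin_theta G i : sin (theta G i) = if left_turn G i then 1 else - 1.
Proof.
rewrite thetaE; case: ifP => _; first exact: sin_pihalf.
have -> : 3 * pi / 2 = pi / 2 + pi :> R by field.
by rewrite sinDpi sin_pihalf.
Qed.

Lemma transitionE G i :
  transition G i = if halfline G i then 0
                   else if left_turn G i == left_turn G (i + 1)
                        then (if left_turn G i then - 1 else 1) else 0.
Proof.
rewrite /transition !thetaE; case: ifP => // _.
have h : (pi / 2 == 3 * pi / 2 :> R) = false by rewrite eq_sym pi_half_neq.
by case: (left_turn G i); case: (left_turn G (i + 1));
  rewrite /= ?eqxx ?pi_half_neq ?h /=.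
Qed.

Lemma transition_sqr G i : transition G i != 0 -> transition G i ^+ 2 = 1.
Proof.
rewrite transitionE; case: (halfline G i) => //.
by case: (left_turn G i == _) => //; case: (left_turn G i).
Qed.

Lemma transition_neq0 G i : transition G i != 0 ->
  left_turn G i = left_turn G (i + 1) /\
  transition G i = if left_turn G i then - 1 else 1.
Proof.
rewrite transitionE; case: (halfline G i) => //.
by case: (left_turn G i =P _) => // ->.
Qed.

Lemma transition_eq0 G i : ~~ halfline G i -> transition G i = 0 ->
  left_turn G (i + 1) = ~~ left_turn G i.
Proof.
rewrite transitionE => /negbTE->.
by case: (left_turn G i); case: (left_turn G (i + 1)).
Qed.

Lemma transition_succ G i : transition G i != 0 -> transition G (i + 1) != 0 ->
  transition G (i + 1) = transition G i.
Proof. by move=> /transition_neq0[-> ->] /transition_neq0[_ ->]. Qed.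

(** A segment with transition number 0 has different turns at its two ends, so the sign changes
    across it. *)
Lemma transition_opp G i : transition G i != 0 -> transition G (i + 1) = 0 ->
  ~~ halfline G (i + 1) -> transition G (i + 2) != 0 ->
  transition G (i + 2) = - transition G i.
Proof.
move=> /transition_neq0[-> ->] h0 hl /transition_neq0[_ ->].
have := transition_eq0 hl h0; rewrite -addrA => ->.
by case: (left_turn G (i + 1)).
Qed.

Definition weight G i : R := (transition G i)%:~R ^+ 2 / len G i ^+ 2.

Definition stationary_at alpha G i : Prop :=
  (transition G i)%:~R
    + 2 * alpha
      * ((transition G (i - 1))%:~R ^+ 2
           / (len G (i - 1) ^+ 2 * sin (theta G i))
         + (transition G (i + 1))%:~R ^+ 2
           / (len G (i + 1) ^+ 2 * sin (theta G (i + 1)))) = 0.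

(** Testing the weight [q] instead of the transition number makes the recurrence one on real numbers
    alone; the two tests agree when lengths are positive. *)
Definition step K (p q : R) : R := if q == 0 then p else K - p.

(** Four cases by the turns at both ends. With equal turns both sines have the sign opposite to the
    transition number, and the equation fixes the sum of the two weights. With different turns the
    transition number is 0 and the two terms have opposite signs, so they cancel exactly when the
    weights are equal. *)
Lemma stationary_atP alpha G i : 0 < alpha -> ~~ halfline G i ->
  stationary_at alpha G i <->
  weight G (i + 1) =
    if transition G i == 0 then weight G (i - 1)
    else (2 * alpha)^-1 - weight G (i - 1).
Proof.
move=> a0 hl; rewrite /stationary_at !sin_theta.
have wE j (s : R) : (transition G j)%:~R ^+ 2 / (len G j ^+ 2 * s) =
  weight G j / s
    by rewrite invfM mulrA.
rewrite !wE.
set p := weight G (i - 1); set q := weight G (i + 1).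
have a2 : 2 * alpha != 0 by rewrite mulf_neq0 // lt0r_neq0.
have hE : 2 * alpha * (2 * alpha)^-1 = 1 by rewrite mulfV.
rewrite transitionE (negbTE hl).
case: (left_turn G i); case: (left_turn G (i + 1)) => /=;
  rewrite ?invrN ?invr1 ?mulr1 ?mulrN1.
- split=> [h|->]; last by rewrite [_%:~R]mulrN1z; lra.
  have : 2 * alpha * (p + q) = 2 * alpha * (2 * alpha)^-1.
    by rewrite hE; move: h; rewrite mulrN1z; lra.
  by move=> /(mulfI a2); lra.
- rewrite add0r; split=> [/eqP|->]; last by rewrite subrr mulr0.
  by rewrite mulf_eq0 (negbTE a2) /= subr_eq0 => /eqP.
- rewrite add0r; split=> [/eqP|->]; last by rewrite addNr mulr0.
  by rewrite mulf_eq0 (negbTE a2) /= addrC subr_eq0 => /eqP.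
- split=> [h|->]; last by lra.
  have : 2 * alpha * (p + q) = 2 * alpha * (2 * alpha)^-1.
    by rewrite hE; lra.
  by move=> /(mulfI a2); lra.
Qed.

Lemma weight_eq0 G i : 0 < len G i -> (weight G i == 0) = (transition G i == 0).
Proof.
move=> l0; rewrite /weight mulf_eq0 invr_eq0 !expf_eq0 /= intr_eq0.
by rewrite (gt_eqF l0) orbF.
Qed.

Lemma weight_neq0 G i : transition G i != 0 -> weight G i = (len G i ^+ 2)^-1.
Proof.
by move=> /transition_sqr h; rewrite /weight -rmorphXn /= h mul1r.
Qed.

(** Here [K] is a squared length, the inverse of a weight; elsewhere [K] denotes
    [(2 * alpha)^-1]. *)
Lemma len_weight G i K : 0 < len G i -> weight G i = K^-1 -> K != 0 ->
  len G i = Num.sqrt K.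
Proof.
move=> l0 wK K0.
have c0 : transition G i != 0 by rewrite -weight_eq0 // wK invr_eq0.
move: wK; rewrite weight_neq0 // => /invr_inj <-.
by rewrite sqrtr_sqr gtr0_norm.
Qed.

(** The bound [N] on the recurrence for [v] is there because stationarity of an unbounded curve
    stops at its last half-line; [w] will be an explicit solution. *)
Lemma step_unique K N (v w : nat -> R) :
  (forall k, (k.+2 <= N)%N -> v k.+2 = step K (v k) (v k.+1)) ->
  (forall k, w k.+2 = step K (w k) (w k.+1)) ->
  v 0%N = w 0%N -> v 1%N = w 1%N -> forall k, (k <= N)%N -> v k = w k.
Proof.
move=> hv hw h0 h1 k.
(* The recurrence has order two, so the induction carries two consecutive values. *)
suff : ((k <= N)%N -> v k = w k) /\ ((k.+1 <= N)%N -> v k.+1 = w k.+1).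
  by case.
elim: k => [//|k [IH1 IH2]]; split=> // kN.
by rewrite hv // hw IH1 ?IH2 // ltnW // ltnW.
Qed.

Definition pat3 K (k : nat) : R := if (3 %| k)%N then 0 else K.
Definition pat4 K A (k : nat) : R :=
  nth 0 [:: 0; A; K; K - A; 0; K - A; K; A] (k %% 8).

Lemma pat3_step K k : K != 0 ->
  pat3 K k.+2 = step K (pat3 K k) (pat3 K k.+1).
Proof.
move=> K0; rewrite /pat3 /step /dvdn -addn2 -[k.+1]addn1 -!(modnDml k).
have := ltn_pmod k (isT : (0 < 3)%N).
by case: (k %% 3)%N => [|[|[|]]] //= _;
  rewrite ?eqxx ?(negbTE K0) ?subr0 ?subrr.
Qed.

(** The conditions keep the zeros of the pattern at the multiples of 4, where [step] must take its
    first branch. For [A = K] the solution would be [pat3], for [A = 0] it would vanish. *)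
Lemma pat4_step K A k : K != 0 -> A != 0 -> K - A != 0 ->
  pat4 K A k.+2 = step K (pat4 K A k) (pat4 K A k.+1).
Proof.
move=> K0 A0 B0; rewrite /pat4 /step -addn2 -[k.+1]addn1 -!(modnDml k).
have := ltn_pmod k (isT : (0 < 8)%N).
by case: (k %% 8)%N => [|[|[|[|[|[|[|[|]]]]]]]] //= _;
  rewrite ?eqxx ?(negbTE K0) ?(negbTE A0) ?(negbTE B0) ?subr0 ?subrr ?subKr.
Qed.

End Turns.

(** * Axis-parallel directions *)

Section AxisVectors.
Variable R : realType.
Implicit Types (G : polycurve R) (i j : int) (x y : R * R) (b : bool).

Definition axis x : Prop := [\/ x = e1, x = - e1, x = e2 | x = - e2].

(** The quarter turn at a corner with [left_turn] equal to [b]. *)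
Definition turn b x : R * R := if b then rot90 x else - rot90 x.

Lemma rot90K x : rot90 (rot90 x) = - x.
Proof. by case: x. Qed.

Lemma rot90_inj : injective (@rot90 R).
Proof. by move=> x y /(congr1 (@rot90 R)); rewrite !rot90K => /oppr_inj. Qed.

Lemma rot90N x : rot90 (- x) = - rot90 x.
Proof. by case: x. Qed.

Lemma rot90B x y : rot90 (x - y) = rot90 x - rot90 y.
Proof. by case: x y => a b [c d]; congr (_, _); rewrite /= opprD. Qed.

Lemma rot90Z s x : rot90 (scale s x) = scale s (rot90 x).
Proof. by case: x => a b; congr (_, _); rewrite /= mulrN. Qed.

Lemma scale_fst s x : (scale s x).1 = s * x.1.
Proof. by []. Qed.

Lemma scale_snd s x : (scale s x).2 = s * x.2.
Proof. by []. Qed.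

Lemma scaleN s x : scale s (- x) = - scale s x.
Proof. by case: x => a b; congr (_, _); rewrite /= mulrN. Qed.

Lemma scale1v x : scale 1 x = x.
Proof. by case: x => a b; congr (_, _); rewrite /= mul1r. Qed.

Lemma scaleA s t x : scale s (scale t x) = scale (s * t) x.
Proof. by rewrite /scale /= !mulrA. Qed.

Lemma dot_rot90 x y : dot (rot90 x) (rot90 y) = dot x y.
Proof. by case: x y => a b [c d]; rewrite /dot /=; ring. Qed.

Lemma axisN x : axis x -> axis (- x).
Proof.
by case=> ->; rewrite ?opprK;
  [apply: Or42 | apply: Or41 | apply: Or44 | apply: Or43].
Qed.

Lemma axis_rot90 x : axis x -> axis (rot90 x).
Proof.
case=> ->; [apply: Or43 | apply: Or44 | apply: Or42 | apply: Or41];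
  by congr (_, _); rewrite /= ?oppr0 ?opprK.
Qed.

Lemma axis_turn b x : axis x -> axis (turn b x).
Proof. by move=> h; case: b; [|apply: axisN]; apply: axis_rot90. Qed.

Lemma rot90_axis x : axis (rot90 x) -> axis x.
Proof. by move=> /axis_rot90/axisN; rewrite rot90K opprK. Qed.

Lemma axis_unit x : axis x -> dot x x = 1.
Proof. by case=> ->; rewrite /dot /=; ring. Qed.

Lemma dot_turn b x : dot x (turn b x) = 0.
Proof. by case: b x => -[a b]; rewrite /dot /=; ring. Qed.

Lemma orthogonal_axis x y : axis x -> axis y -> dot x y = 0 ->
  exists b, y = turn b x.
Proof.
move=> [] -> [] -> //; rewrite /dot /= => h; try (exfalso; lra);
  by [exists true; congr (_, _) => /=; lra | exists false; congr (_, _) => /=; lra].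
Qed.

Lemma dotZl s x y : dot (scale s x) y = s * dot x y.
Proof. by rewrite /dot /=; ring. Qed.

Lemma dotZr s x y : dot x (scale s y) = s * dot x y.
Proof. by rewrite /dot /=; ring. Qed.

Lemma dotDr x y z : dot x (y + z) = dot x y + dot x z.
Proof. by rewrite /dot /=; ring. Qed.

Lemma dotC x y : dot x y = dot y x.
Proof. by rewrite /dot /=; ring. Qed.

Lemma dotNr x y : dot x (- y) = - dot x y.
Proof. by rewrite /dot /=; ring. Qed.

Lemma dot_rot90l x : dot (rot90 x) x = 0.
Proof. by rewrite /dot /=; ring. Qed.

Lemma len_gt0 G i : vtx G (i + 1) != vtx G i -> 0 < len G i.
Proof.
rewrite -subr_eq0 -/(edge G i) /len /enorm sqrtr_gt0 /dot.
case: (edge G i) => a b h /=.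
rewrite lt0r -!expr2 addr_ge0 ?sqr_ge0 // andbT.
rewrite paddr_eq0 ?sqr_ge0 // !sqrf_eq0.
by apply: contra h => /andP[/eqP-> /eqP->].
Qed.

Lemma edgeE G i : 0 < len G i -> edge G i = scale (len G i) (tangent G i).
Proof. by move=> l0; rewrite scaleA mulfV ?lt0r_neq0 // scale1v. Qed.

Lemma enormZ s x : 0 <= s -> dot x x = 1 -> enorm (scale s x) = s.
Proof.
move=> s0 x1; rewrite /enorm dotZl dotZr x1 mulr1 -expr2 sqrtr_sqr.
by rewrite ger0_norm.
Qed.

(** The cone is spanned by [- T] and [T'], and [rot90 T] is orthogonal to [T], so the first
    inner-normal condition only concerns its product with [T']. By antisymmetry the second condition
    has the same content. *)
Lemma left_turnE G i :
  left_turn G i = (0 <= dot (normal G (i - 1)) (tangent G i)).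
Proof.
rewrite left_turnP /inner_normal /cone /normal.
move: (tangent G (i - 1)) (tangent G i) => T T'.
have c2 : dot (rot90 T') T = - dot (rot90 T) T' by rewrite /dot /=; ring.
apply/asboolP/idP => [[h _]|c0].
- have : 0 <= dot (rot90 T) (scale 0 (- T) + scale 1 T').
    by apply: h; exists 0, 1; split.
  by rewrite dotDr !dotZr mul0r mul1r add0r.
- split=> x [s [t [s0 t0 ->]]]; rewrite dotDr !dotZr dotNr dot_rot90l.
    by rewrite oppr0 mulr0 add0r mulr_ge0.
  by rewrite c2 opprK mulr0 addr0 mulr_ge0.
Qed.

Lemma left_turn_turn G i b : dot (tangent G (i - 1)) (tangent G (i - 1)) = 1 ->
  tangent G i = turn b (tangent G (i - 1)) -> left_turn G i = b.
Proof.
move=> T1; rewrite left_turnE /normal => ->.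
case: b; rewrite /turn ?dotNr dot_rot90 T1 ?ler01 //.
by rewrite oppr_ge0 ler10.
Qed.

Section Admissible.
Variable G : polycurve R.
Hypothesis adm : admissible G.

Lemma tangent_axis i : in_range G i -> axis (tangent G i).
Proof. by move=> /adm.1 h; apply: rot90_axis. Qed.

Lemma tangent_turn i : corner G i -> axis (tangent G (i - 1)) ->
  axis (tangent G i) ->
  tangent G i = turn (left_turn G i) (tangent G (i - 1)).
Proof.
move=> ci T T'; have [b hb] := orthogonal_axis T T' (adm.2 i ci).
by rewrite (left_turn_turn (axis_unit T) hb).
Qed.

End Admissible.

Lemma transition_mul_succ G i :
  transition G i != 0 -> transition G (i + 1) != 0 ->
  0 < transition G i * transition G (i + 1).
Proof.
by move=> h0 h1; rewrite (transition_succ h0 h1) -expr2 transition_sqr.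
Qed.

Lemma transition_mul_opp G i : transition G i != 0 ->
  transition G (i + 1) = 0 -> ~~ halfline G (i + 1) ->
  transition G (i + 2) != 0 -> transition G i * transition G (i + 2) < 0.
Proof.
move=> h0 h1 h2 h3; rewrite (transition_opp h0 h1 h2 h3) mulrN -expr2.
by rewrite transition_sqr.
Qed.

End AxisVectors.

(** * Unbounded curves *)

Section Unbounded.
Variables (R : realType) (alpha : R) (G : polycurve R).
Hypotheses (alpha_gt0 : 0 < alpha) (unb : unbounded_curve G).
Hypotheses (adm : admissible G) (stat : stationary alpha G).
Implicit Types k : nat.
Let n := nseg G.
Let K : R := (2 * alpha)^-1.
(** The shift by one gives the first half-line index 0 and the last one index [n.-1], matching the
    patterns, which start with 0. *)
Let v k : R := weight G k.+1.

Let halflineE i : halfline G i = (i == 1) || (i == n).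
Proof. by rewrite /halfline /first_halfline /last_halfline; case: unb => ->. Qed.

Let n_ge2 : (2 <= n)%N.
Proof. by case: unb. Qed.

Let K_neq0 : K != 0.
Proof. by rewrite invr_neq0 // mulf_neq0 // lt0r_neq0. Qed.

Let sqrtK : Num.sqrt K^-1 = Num.sqrt (2 * alpha).
Proof. by rewrite /K invrK. Qed.

Let lenk_gt0 k : (k.+1 <= n)%N -> 0 < len G k.+1.
Proof.
case: unb => _ _ h kn; apply/len_gt0/h.
by rewrite /in_range; move: kn; rewrite /n; lia.
Qed.

Let v_eq0 k : (k.+1 <= n)%N -> (v k == 0) = (transition G k.+1 == 0).
Proof. by move=> kn; rewrite /v weight_eq0 ?lenk_gt0. Qed.

Let weight_halfline i : halfline G i -> weight G i = 0.
Proof. by rewrite /weight transitionE => ->; rewrite expr0n mul0r. Qed.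

Let v_first : v 0 = 0.
Proof. by apply: weight_halfline; rewrite halflineE. Qed.

Let v_last : v n.-1 = 0.
Proof.
by apply: weight_halfline; rewrite halflineE; apply/orP; right; lia.
Qed.

Let v_step k : (k.+2 <= n.-1)%N -> v k.+2 = step K (v k) (v k.+1).
Proof.
move=> kn; have hl : ~~ halfline G k.+2 by rewrite halflineE; lia.
have ir : in_range G k.+2 by rewrite /in_range -/n; lia.
have /(stationary_atP alpha_gt0 hl) := stat ir hl.
rewrite /step v_eq0; last by lia.
have -> : k.+2%:Z + 1 = k.+3 by lia.
by have -> : k.+2%:Z - 1 = k.+1 by lia.
Qed.

Let v_pat (w : nat -> R) :
  (forall k, w k.+2 = step K (w k) (w k.+1)) -> w 0 = 0 -> v 1 = w 1%N ->
  forall k, (k < n)%N -> v k = w k.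
Proof.
move=> hw w0 w1 k kn; apply: (step_unique v_step hw) => //; last by lia.
by rewrite v_first w0.
Qed.

(** Two consecutive zero weights make all weights vanish, and a bounded segment with transition
    number 0 has different turns at its ends. For [n = 2] the hypothesis holds because [S_2] is a
    half-line. *)
Lemma unbounded_staircase : weight G 2 = 0 -> staircase G.
Proof.
move=> v1; split=> [//|i i_in].
have hl : ~~ halfline G i by rewrite halflineE; move: i_in; rewrite -/n; lia.
have ir : in_range G i by rewrite /in_range; move: i_in; lia.
have c0 : transition G i = 0.
  have -> : i = (`|i|.-1).+1 by lia.
  apply/eqP; rewrite -v_eq0; last by move: i_in; rewrite -/n; lia.
  apply/eqP/(@v_pat (fun=> 0)) => //; last by move: i_in; rewrite -/n; lia.
  by move=> k; rewrite /step eqxx.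
have := transition_eq0 hl c0; rewrite /left_turn => h e.
by move: h; rewrite e; case: (_ == _).
Qed.

Section RightAngles.
Hypotheses (v1 : weight G 2 != 0) (v3 : weight G 4 = 0).

(** The weight of [S_4] is K minus that of [S_2]; its vanishing makes [S_2] and [S_3] equally long
    and turns the solution into [pat3]. The zero at the last half-line then gives [3 %| n.-1]. *)
Lemma unbounded_right_angles : exists m, (1 <= m)%N /\ right_angle_chain alpha m G.
Proof.
(* If [S_2], or below [S_3], were the last half-line, its weight would be 0. *)
have n_gt2 : (2 < n)%N.
  rewrite ltn_neqAle n_ge2 andbT; apply/eqP => n2.
  by move: v1; rewrite -[weight G 2]/(v 1) (_ : 1%N = n.-1) ?v_last ?eqxx // -n2.
have v2 : v 2 = K.
  by rewrite v_step ?v_first /step; [rewrite (negbTE v1) subr0 | lia].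
have n_gt3 : (3 < n)%N.
  rewrite ltn_neqAle n_gt2 andbT; apply/eqP => n2.
  by move: K_neq0; rewrite -v2 (_ : 2%N = n.-1) ?v_last ?eqxx // -n2.
have v1K : v 1 = K.
  have := @v_step 1; rewrite /step v2 (negbTE K_neq0) => /(_ ltac:(lia)).
  by rewrite [v 3]v3 => /eqP; rewrite eq_sym subr_eq0 => /eqP.
have vE := v_pat (fun k => pat3_step k K_neq0) erefl v1K.
have cE k : (k.+1 <= n)%N -> (transition G k.+1 == 0) = (3 %| k)%N.
  move=> kn; rewrite -v_eq0 // vE // /pat3; case: ifP; rewrite ?eqxx //.
  by rewrite (negbTE K_neq0).
have lE k : (k.+1 <= n)%N -> ~~ (3 %| k)%N -> len G k.+1 = Num.sqrt (2 * alpha).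
  move=> kn k3; rewrite -sqrtK; apply: len_weight; rewrite ?lenk_gt0 //.
    by rewrite -[LHS]/(v k) vE // /pat3 (negbTE k3) invrK.
  by rewrite invr_eq0.
have /dvdnP[m nE] : (3 %| n.-1)%N.
  have := v_last; rewrite vE ?/pat3; last by lia.
  by case: ifP => // _ /eqP; rewrite (negbTE K_neq0).
have c1 k : (k <= m)%N -> transition G (3 * k + 1)%N = 0.
  by move=> km; apply/eqP; rewrite addn1 cE; lia.
have c2 k : (k < m)%N -> transition G (3 * k + 2)%N != 0.
  by move=> km; rewrite addnS cE; lia.
have c3 k : (k < m)%N -> transition G (3 * k + 3)%N != 0.
  by move=> km; rewrite addnS cE; lia.
have m_gt0 : (0 < m)%N by lia.
exists m; split => //; split=> [|k km|k km|k km].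
- by rewrite -/n; lia.
- split; last 2 first.
  + by rewrite addnS lE //; lia.
  + by rewrite addnS lE //; lia.
  split.
  + have -> : (3 * k + 2)%N%:Z - 1 = (3 * k + 1)%N by lia.
    by apply: c1; lia.
  + apply: transition_mul_succ; first exact: c2.
    have -> : (3 * k + 2)%N%:Z + 1 = (3 * k + 3)%N by lia.
    exact: c3.
  + have -> : (3 * k + 2)%N%:Z + 2 = (3 * k.+1 + 1)%N by lia.
    exact: c1.
- have km' : (k < m)%N by lia.
  have e1 : (3 * k + 2)%N%:Z + 1 = (3 * k + 3)%N by lia.
  rewrite /opposite_transition.
  have := @transition_succ _ G (3 * k + 2)%N; rewrite e1.
  move=> /(_ (c2 _ km') (c3 _ km')) <-.
  have e2 : (3 * k + 3)%N%:Z + 2 = (3 * k.+1 + 2)%N by lia.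
  have e3 : (3 * k + 3)%N%:Z + 1 = (3 * k.+1 + 1)%N by lia.
  rewrite -e2; apply: transition_mul_opp; rewrite ?e2 ?e3.
  + exact: c3.
  + exact: c1.
  + by rewrite halflineE; lia.
  + exact: c2.
- have c0 : transition G (3 * k + 1)%N = 0 by apply: c1; lia.
  by split=> //; rewrite /phi_curvature c0 mulr0 mul0r; case: ifP.
Qed.

End RightAngles.

Section DoubleRightAngles.
Hypotheses (v1 : weight G 2 != 0) (v3 : weight G 4 != 0).
Hypothesis hor : horizontal G 2.

(** Each corner exchanges the two axes, so the parity of the index decides. *)
Lemma horizontal_even k : (0 < k <= n)%N ->
  if odd k then vertical G k else horizontal G k.
Proof.
move=> kn.
have tE j : (0 < j <= n)%N -> axis (tangent G j).
  by move=> h; apply: tangent_axis => //; rewrite /in_range -/n; lia.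
have eE j : (0 < j <= n)%N -> edge G j = scale (len G j) (tangent G j).
  by case: j => // j h; rewrite edgeE // lenk_gt0.
have tt j : (0 < j)%N -> (j.+1 <= n)%N ->
    exists b, tangent G j.+1 = turn b (tangent G j).
  move=> j0 jn; exists (left_turn G j.+1).
  have e : j.+1%:Z - 1 = j by lia.
  rewrite (@tangent_turn _ _ adm j.+1) ?e //.
  - by rewrite /corner /in_range -/n; lia.
  - by apply: tE; lia.
  - by apply: tE; lia.
have l0 j : (0 < j <= n)%N -> 0 < len G j.
  by case: j => // j h; apply: lenk_gt0; lia.
have t2 : (tangent G 2).2 = 0.
  move: hor; rewrite /horizontal (eE 2%N) ?n_ge2 // scale_snd => /eqP.
  by rewrite mulf_eq0 gt_eqF ?l0 //= => /eqP.
have t1 : (tangent G 1).1 = 0.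
  move: t2; have [b ->] := @tt 1%N isT n_ge2.
  by case: b => /=; lra.
suff tk : if odd k then (tangent G k).1 = 0 else (tangent G k).2 = 0.
  rewrite /vertical /horizontal eE // scale_fst scale_snd.
  by move: tk; case: ifP => _ ->; rewrite mulr0.
elim: k kn => [//|[//|k] IH] kn.
have [b ->] := @tt k.+1 isT ltac:(lia).
have := IH ltac:(lia); rewrite [odd k.+2]oddS; case: (odd k.+1) => /= h;
  by case: b => /=; lra.
Qed.

(** The relation between [a] and [b] says that the weights of [S_2] and [S_4], which are A and K -
    A, add up to K. *)
Lemma unbounded_double_right_angles (a := len G 2) (b := len G 4) : exists m,
  [/\ (1 <= m)%N, 0 < a, 0 < b, 1 / a ^+ 2 + 1 / b ^+ 2 = 1 / (2 * alpha)
    & double_right_angle_chain alpha a b m G].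
Proof.
have n_gt2 : (2 < n)%N.
  rewrite ltn_neqAle n_ge2 andbT; apply/eqP => n2.
  by move: v1; rewrite -[weight G 2]/(v 1) (_ : 1%N = n.-1) ?v_last ?eqxx // -n2.
have v2 : v 2 = K.
  by rewrite v_step ?v_first /step; [rewrite (negbTE v1) subr0 | lia].
have n_gt3 : (3 < n)%N.
  rewrite ltn_neqAle n_gt2 andbT; apply/eqP => n2.
  by move: K_neq0; rewrite -v2 (_ : 2%N = n.-1) ?v_last ?eqxx // -n2.
have v3E : v 3 = K - v 1.
  by rewrite v_step /step ?v2 ?(negbTE K_neq0) //; lia.
have B0 : K - v 1 != 0 by rewrite -v3E.
have A0 : v 1 != 0 by [].
have vE : forall k, (k < n)%N -> v k = pat4 K (v 1) k.
  by apply: v_pat => // k; apply: pat4_step.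
have cE k : (k.+1 <= n)%N -> (transition G k.+1 == 0) = (4 %| k)%N.
  move=> kn; rewrite -v_eq0 // vE // /pat4.
  rewrite /dvdn -(@modn_dvdm 8 k 4) //.
  have := ltn_pmod k (isT : (0 < 8)%N).
  by case: (k %% 8)%N => [|[|[|[|[|[|[|[|]]]]]]]] //= _;
    rewrite ?eqxx ?(negbTE K_neq0) ?(negbTE A0) ?(negbTE B0).
have /dvdnP[m nE] : (4 %| n.-1)%N.
  by rewrite -cE -?v_eq0 ?v_last //; lia.
have m_gt0 : (0 < m)%N by lia.
have c1 k : (k <= m)%N -> transition G (4 * k + 1)%N = 0.
  by move=> km; apply/eqP; rewrite addn1 cE; lia.
have c2 k : (k < m)%N -> transition G (4 * k + 2)%N != 0.
  by move=> km; rewrite addnS cE; lia.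
have c3 k : (k < m)%N -> transition G (4 * k + 3)%N != 0.
  by move=> km; rewrite addnS cE; lia.
have c4 k : (k < m)%N -> transition G (4 * k + 4)%N != 0.
  by move=> km; rewrite addnS cE; lia.
have l2 := @lenk_gt0 1 ltac:(lia); have l4 := @lenk_gt0 3 ltac:(lia).
have w2 : v 1 = (len G 2 ^+ 2)^-1 by apply: weight_neq0; rewrite -v_eq0 //; lia.
have w4 : v 3 = (len G 4 ^+ 2)^-1 by apply: weight_neq0; rewrite -v_eq0 //; lia.
(* In [pat4] the value A stands at the residues 1 and 7, the value K - A at 3 and 5. Segment numbers
   exceed these indices by one. *)
have lE k : (k.+1 <= n)%N -> (k %% 8 = 1)%N \/ (k %% 8 = 7)%N -> len G k.+1 = len G 2.
  move=> kn k8; rewrite -[RHS]gtr0_norm // -sqrtr_sqr; apply: len_weight.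
  - exact: lenk_gt0.
  - by rewrite -w2 -[LHS]/(v k) vE // /pat4; case: k8 => ->.
  - by rewrite sqrf_eq0 gt_eqF.
have lE' k : (k.+1 <= n)%N -> (k %% 8 = 3)%N \/ (k %% 8 = 5)%N -> len G k.+1 = len G 4.
  move=> kn k8; rewrite -[RHS]gtr0_norm // -sqrtr_sqr; apply: len_weight.
  - exact: lenk_gt0.
  - by rewrite -w4 -[LHS]/(v k) v3E vE // /pat4; case: k8 => ->.
  - by rewrite sqrf_eq0 gt_eqF.
exists m; split=> //.
  by rewrite !div1r -w2 -w4 v3E addrC subrK.
split=> [|k km|k km|k|k km].
- by rewrite -/n; lia.
- have e0 : (4 * k + 2)%N%:Z - 1 = (4 * k + 1)%N by lia.
  have e1 : (4 * k + 2)%N%:Z + 1 = (4 * k + 3)%N by lia.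
  have e2 : (4 * k + 2)%N%:Z + 2 = (4 * k + 4)%N by lia.
  have e3 : (4 * k + 2)%N%:Z + 3 = (4 * k.+1 + 1)%N by lia.
  split; last first.
    rewrite -sqrtK addnS; apply: len_weight; last by rewrite invr_eq0.
      by apply: lenk_gt0; lia.
    rewrite invrK -[LHS]/(v _) vE /pat4; last by lia.
    have : ((4 * k + 2) %% 8 == 2)%N || ((4 * k + 2) %% 8 == 6)%N by lia.
    by case/orP => /eqP->.
  split; rewrite ?e0 ?e1 ?e2 ?e3.
  + by apply: c1; lia.
  + by rewrite -e1; apply: transition_mul_succ; rewrite ?e1; [apply: c2|apply: c3].
  + have e4 : (4 * k + 3)%N%:Z + 1 = (4 * k + 4)%N by lia.
    by rewrite -e4; apply: transition_mul_succ; rewrite ?e4; [apply: c3|apply: c4].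
  + exact: c1.
  + have h2 : horizontal G (4 * k + 2)%N.
      have := @horizontal_even (4 * k + 2)%N ltac:(lia).
      by rewrite oddD oddM.
    have h3 : vertical G (4 * k + 3)%N.
      have := @horizontal_even (4 * k + 3)%N ltac:(lia).
      by rewrite oddD oddM.
    have h4 : horizontal G (4 * k + 4)%N.
      have := @horizontal_even (4 * k + 4)%N ltac:(lia).
      by rewrite oddD oddM.
    by [].
- have km' : (k < m)%N by lia.
  have e1 : (4 * k + 2)%N%:Z + 1 = (4 * k + 3)%N by lia.
  have e2 : (4 * k + 3)%N%:Z + 1 = (4 * k + 4)%N by lia.
  rewrite /opposite_transition.
  have := @transition_succ _ G (4 * k + 2)%N; rewrite e1.
  move=> /(_ (c2 _ km') (c3 _ km')) <-.
  have := @transition_succ _ G (4 * k + 3)%N; rewrite e2.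
  move=> /(_ (c3 _ km') (c4 _ km')) <-.
  have e3 : (4 * k + 4)%N%:Z + 2 = (4 * k.+1 + 2)%N by lia.
  have e4 : (4 * k + 4)%N%:Z + 1 = (4 * k.+1 + 1)%N by lia.
  rewrite -e3; apply: transition_mul_opp; rewrite ?e3 ?e4.
  + exact: c4.
  + exact: c1.
  + by rewrite halflineE; lia.
  + exact: c2.
- rewrite -/n; split=> kn.
  + by rewrite addnS lE //; lia.
  + by have -> : (8 * k = (8 * k).-1.+1)%N by [lia]; rewrite lE //; lia.
  + by rewrite addnS lE' //; lia.
  + by rewrite addnS lE' //; lia.
- have c0 : transition G (4 * k + 1)%N = 0 by apply: c1; lia.
  by split=> //; rewrite /phi_curvature c0 mulr0 mul0r; case: ifP.
Qed.

End DoubleRightAngles.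
End Unbounded.

(** * Invariance under quarter turns, translations and shifts of the index *)

Section Transport.
Variable R : realType.
Implicit Types (G : polycurve R) (i : int).

Section EdgeTransport.
Variables (G G' : polycurve R) (s : int) (r : R * R -> R * R).
Hypothesis rE : r = id \/ r = @rot90 R.
Hypothesis edge_eq : forall i, edge G' i = r (edge G (i + s)).

Let dot_r x y : dot (r x) (r y) = dot x y.
Proof. by case: rE => -> //; rewrite dot_rot90. Qed.

Let r_scale c x : r (scale c x) = scale c (r x).
Proof. by case: rE => -> //; rewrite rot90Z. Qed.

Let r_rot90 x : r (rot90 x) = rot90 (r x).
Proof. by case: rE => ->. Qed.

(** Lengths, tangents and turns depend on the edges alone. A hypothesis on edges, with a rotation
    [r] and an index shift [s], thus covers quarter turns, translations, cyclic relabelling and,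
    with [G' = G], periodicity. Half-lines depend on the index and are handled by a separate
    hypothesis. *)
Lemma len_transport i : len G' i = len G (i + s).
Proof. by rewrite /len /enorm edge_eq dot_r. Qed.

Lemma tangent_transport i : tangent G' i = r (tangent G (i + s)).
Proof. by rewrite /tangent len_transport edge_eq r_scale. Qed.

Lemma tangent_transport_axis i : axis (tangent G (i + s)) -> axis (tangent G' i).
Proof.
by rewrite tangent_transport; case: rE => -> // h; apply: axis_rot90.
Qed.

Lemma tangent_transport_dot i :
  dot (tangent G' (i - 1)) (tangent G' i) =
  dot (tangent G (i + s - 1)) (tangent G (i + s)).
Proof. by rewrite !tangent_transport dot_r addrAC. Qed.

Lemma left_turn_transport i : left_turn G' i = left_turn G (i + s).
Proof.
by rewrite !left_turnE /normal !tangent_transport -r_rot90 dot_r addrAC.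
Qed.

Lemma theta_transport i : theta G' i = theta G (i + s).
Proof. by rewrite !thetaE left_turn_transport. Qed.

Hypothesis halfline_eq : forall i, halfline G' i = halfline G (i + s).

Lemma transition_transport i : transition G' i = transition G (i + s).
Proof. by rewrite !transitionE halfline_eq !left_turn_transport addrAC. Qed.

Lemma weight_transport i : weight G' i = weight G (i + s).
Proof. by rewrite /weight transition_transport len_transport. Qed.

Lemma stationary_transport alpha i :
  stationary_at alpha G (i + s) -> stationary_at alpha G' i.
Proof.
rewrite /stationary_at !transition_transport !len_transport !theta_transport.
by rewrite ![i + _ + s]addrAC.
Qed.

End EdgeTransport.

Lemma edge_move_rot90 G i : edge (move (@rot90 R) G) i = rot90 (edge G i).
Proof. by rewrite /edge rot90B. Qed.

Lemma edge_move_translation G v i : edge (move (fun x => x + v) G) i = edge G i.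
Proof. by rewrite /edge /= opprD addrACA subrr addr0. Qed.

Lemma edge_relabel G k i : edge (relabel k G) i = edge G (i + k).
Proof. by rewrite /edge /= addrAC. Qed.

Lemma move_id G : move id G = G.
Proof. by case: G. Qed.

Section UnboundedRotation.
Variables (alpha : R) (G : polycurve R).
Hypotheses (unb : unbounded_curve G) (adm : admissible G).
Hypothesis (stat : stationary alpha G).
Let G' := move (@rot90 R) G.

Let eqG i : edge G' i = rot90 (edge G (i + 0)).
Proof. by rewrite addr0 edge_move_rot90. Qed.

Let rE : @rot90 R = id \/ @rot90 R = @rot90 R. Proof. by right. Qed.

Lemma unbounded_rot90 : unbounded_curve G'.
Proof.
case: unb => c n h; split=> // i /h; apply: contra => /eqP e.
by apply/eqP/rot90_inj.
Qed.

Lemma admissible_rot90 : admissible G'.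
Proof.
split=> [i ir|i ci]; last first.
  by rewrite (tangent_transport_dot rE eqG) addr0; apply: adm.2.
apply: axis_rot90; apply: (tangent_transport_axis rE eqG).
by rewrite addr0; apply: tangent_axis.
Qed.

Lemma stationary_rot90 : stationary alpha G'.
Proof.
move=> i ir hl; apply: (stationary_transport rE eqG).
  by move=> j; rewrite addr0.
by rewrite addr0; apply: stat.
Qed.

End UnboundedRotation.

Lemma axis_horizontal_or_vertical G i : 0 < len G i -> axis (tangent G i) ->
  horizontal G i \/ vertical G i.
Proof.
rewrite /horizontal /vertical => l0 h; rewrite edgeE // scale_fst scale_snd.
by case: h => -> /=; rewrite ?oppr0 mulr0; [left|left|right|right].
Qed.

End Transport.

(** * Classification of the unbounded curves *)

Section UnboundedClassification.
Variables (R : realType) (alpha : R) (G : polycurve R).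
Hypotheses (alpha_gt0 : 0 < alpha) (unb : unbounded_curve G).
Hypotheses (adm : admissible G) (stat : stationary alpha G).

(** The weights of [S_2] and [S_4] select the case. In the last one a quarter turn makes [S_2]
    horizontal if it is vertical, and it does not change the weights. *)
Lemma unbounded_classification :
  exists f : R * R -> R * R, motion f /\
    [\/ staircase (move f G),
        exists m : nat, (1 <= m)%N /\ right_angle_chain alpha m (move f G)
      | exists (m : nat) (a b : R),
          [/\ (1 <= m)%N, 0 < a, 0 < b,
              1 / a ^+ 2 + 1 / b ^+ 2 = 1 / (2 * alpha)
            & double_right_angle_chain alpha a b m (move f G)]].
Proof.
have [w2|w2] := eqVneq (weight G 2) 0.
  exists id; split; first exact: motion_id.
  by rewrite move_id; apply: Or31; apply: (@unbounded_staircase _ alpha).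
have [w4|w4] := eqVneq (weight G 4) 0.
  exists id; split; first exact: motion_id.
  by rewrite move_id; apply: Or32; apply: unbounded_right_angles.
have r2 : in_range G 2 by rewrite /in_range; case: unb; lia.
have [h|h] : horizontal G 2 \/ vertical G 2.
  apply: axis_horizontal_or_vertical; last exact: tangent_axis.
  by case: unb => _ _ h; apply/len_gt0/h.
- exists id; split; first exact: motion_id.
  rewrite move_id; have [m hm] := unbounded_double_right_angles alpha_gt0 unb adm stat w2 w4 h.
  by apply: Or33; exists m, (len G 2), (len G 4).
- exists (@rot90 R); split; first exact: motion_rot90.
  have wE i : weight (move (@rot90 R) G) i = weight G i.
    rewrite (@weight_transport _ G _ 0 (@rot90 R)) ?addr0 //; first by right.
    - by move=> j; rewrite edge_move_rot90 addr0.
    - by move=> j; rewrite addr0.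
  set G' := move (@rot90 R) G.
  suff [m hm] : exists m, [/\ (1 <= m)%N, 0 < len G' 2, 0 < len G' 4,
      1 / len G' 2 ^+ 2 + 1 / len G' 4 ^+ 2 = 1 / (2 * alpha)
      & double_right_angle_chain alpha (len G' 2) (len G' 4) m G'].
    by apply: Or33; exists m, (len G' 2), (len G' 4).
  apply: unbounded_double_right_angles; rewrite ?wE //.
  + exact: unbounded_rot90.
  + exact: admissible_rot90.
  + exact: stationary_rot90.
Qed.

End UnboundedClassification.

(** * Closed curves *)

Section ClosedCurves.
Variables (R : realType) (alpha : R).
Implicit Types (G : polycurve R) (i q : int).

(* The hypotheses of the closed case, at every integer index and not only for
   [1 <= i <= nseg G]: in this form they pass to relabelled curves. *)
Definition closed_stationary G : Prop :=
  [/\ is_closed G, (0 < nseg G)%N,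
      forall i, vtx G (i + (nseg G)%:Z) = vtx G i
    & forall i, [/\ 0 < len G i, axis (tangent G i),
                    dot (tangent G (i - 1)) (tangent G i) = 0
                  & stationary_at alpha G i]].

Lemma vtx_periodic G q i : (forall j, vtx G (j + (nseg G)%:Z) = vtx G j) ->
  vtx G (i + q * (nseg G)%:Z) = vtx G i.
Proof.
move=> h; elim: q => [|k IH|k IH]; first by rewrite mul0r addr0.
- by rewrite (_ : _ + _ = i + k%:Z * (nseg G)%:Z + (nseg G)%:Z) ?h //; lia.
- by rewrite -h -IH; congr (vtx G _); lia.
Qed.

Lemma edge_periodic G q i : (forall j, vtx G (j + (nseg G)%:Z) = vtx G j) ->
  edge G (i + q * (nseg G)%:Z) = edge G i.
Proof. by move=> h; rewrite /edge addrAC !vtx_periodic. Qed.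

Lemma halfline_closed G i : is_closed G -> halfline G i = false.
Proof. by rewrite /halfline /first_halfline /last_halfline => ->. Qed.

Section Periodicity.
Variables (G : polycurve R) (q : int).
Hypotheses (cl : is_closed G).
Hypothesis (per : forall i, vtx G (i + (nseg G)%:Z) = vtx G i).
Let s := q * (nseg G)%:Z.

Let eqG i : edge G i = id (edge G (i + s)).
Proof. by rewrite edge_periodic. Qed.

Let idE : @id (R * R) = id \/ @id (R * R) = @rot90 R. Proof. by left. Qed.

Let hlE i : halfline G i = halfline G (i + s).
Proof. by rewrite !halfline_closed. Qed.

Lemma len_periodic i : len G (i + s) = len G i.
Proof. by rewrite -(len_transport idE eqG). Qed.

Lemma transition_periodic i : transition G (i + s) = transition G i.
Proof. by rewrite -(transition_transport idE eqG hlE). Qed.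

Lemma weight_periodic i : weight G (i + s) = weight G i.
Proof. by rewrite -(weight_transport idE eqG hlE). Qed.

Lemma tangent_periodic i : tangent G (i + s) = tangent G i.
Proof. by rewrite -(tangent_transport idE eqG). Qed.

Lemma stationary_periodic i : stationary_at alpha G (i + s) ->
  stationary_at alpha G i.
Proof. exact: (stationary_transport idE eqG hlE). Qed.

End Periodicity.

Lemma in_range_mod G i : (0 < nseg G)%N ->
  exists q, in_range G (i + q * (nseg G)%:Z).
Proof.
move=> n0; exists (- ((i - 1) %/ (nseg G)%:Z)%Z).
have n1 : (nseg G)%:Z != 0 by lia.
have := modz_ge0 (i - 1) n1; have := ltz_mod (i - 1) n1.
have := divz_eq (i - 1) (nseg G)%:Z.
by rewrite /in_range; move: (_ %/ _)%Z (_ %% _)%Z => d r; nia.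
Qed.

Lemma closed_stationaryP G : closed_curve G -> admissible G ->
  stationary alpha G -> closed_stationary G.
Proof.
move=> [cl n0 per h] adm st; split=> // i.
have [q ir] := in_range_mod i n0.
rewrite -(len_periodic q per) -(tangent_periodic q per i).
rewrite -(tangent_periodic q per (i - 1)) addrAC; split.
- exact/len_gt0/h.
- exact: tangent_axis.
- by apply: adm.2; rewrite /corner ir cl.
- by apply: (@stationary_periodic G q cl per); apply: st; rewrite // halfline_closed.
Qed.

Section TransportClosed.
Variables (G G' : polycurve R) (s : int) (r : R * R -> R * R).
Hypothesis rE : r = id \/ r = @rot90 R.
Hypothesis edge_eq : forall i, edge G' i = r (edge G (i + s)).
Hypotheses (clE : is_closed G' = is_closed G).
Hypothesis cs : closed_stationary G.

Lemma transition_transport_closed i : transition G' i = transition G (i + s).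
Proof.
apply: (transition_transport rE edge_eq) => j.
by case: cs => cl _ _ _; rewrite !halfline_closed ?clE.
Qed.

Lemma weight_transport_closed i : weight G' i = weight G (i + s).
Proof.
by rewrite /weight transition_transport_closed (len_transport rE edge_eq).
Qed.

Lemma closed_stationary_transport : (nseg G' = nseg G)%N ->
  (forall i, vtx G' (i + (nseg G)%:Z) = vtx G' i) -> closed_stationary G'.
Proof.
move=> nE per'; case: cs => cl n0 per h; split; rewrite ?nE ?clE // => i.
have [l0 ax dt st] := h (i + s); split.
- by rewrite (len_transport rE edge_eq).
- exact: (tangent_transport_axis rE edge_eq).
- by rewrite (tangent_transport_dot rE edge_eq).
- apply: (stationary_transport rE edge_eq _ st) => j.
  by rewrite !halfline_closed ?clE.
Qed.

End TransportClosed.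

Section RelabelMove.
Variable G : polycurve R.
Hypothesis cs : closed_stationary G.

Let idE : @id (R * R) = id \/ @id (R * R) = @rot90 R. Proof. by left. Qed.

Lemma closed_stationary_relabel k : closed_stationary (relabel k G).
Proof.
apply: (closed_stationary_transport idE (edge_relabel G k)) => // i.
by case: cs => _ _ per _; rewrite /= addrAC per.
Qed.

Lemma transition_relabel k i : transition (relabel k G) i = transition G (i + k).
Proof. exact: (transition_transport_closed idE (edge_relabel G k)). Qed.

Lemma weight_relabel k i : weight (relabel k G) i = weight G (i + k).
Proof. exact: (weight_transport_closed idE (edge_relabel G k)). Qed.

Lemma rotate_closed k : exists f : R * R -> R * R,
  [/\ motion f, closed_stationary (move f G),
      forall i, transition (move f G) i = transition G i,
      forall i, weight (move f G) i = weight G i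
    & forall i, tangent (move f G) i = iter k (@rot90 R) (tangent G i)].
Proof.
elim: k => [|k [f [mf csf cE wE tE]]].
  by exists id; rewrite move_id; split=> //; apply: motion_id.
have rE : @rot90 R = id \/ @rot90 R = @rot90 R by right.
have eE i : edge (move (@rot90 R \o f) G) i = rot90 (edge (move f G) (i + 0)).
  by rewrite addr0 -edge_move_rot90.
exists (@rot90 R \o f); split.
- by apply: motion_comp => //; apply: motion_rot90.
- apply: (closed_stationary_transport rE eE) => // i.
  by case: csf => _ _ per _; rewrite /= -[f _]/(vtx (move f G) _) per.
- by move=> i; rewrite (transition_transport_closed rE eE) // addr0.
- by move=> i; rewrite (weight_transport_closed rE eE) // addr0.
- by move=> i; rewrite (tangent_transport rE eE) addr0 tE.
Qed.

(** Double-right-angle chains are described in a fixed vertical strip. Pointing [S_1] upwards and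
    placing it on the axis of this strip fixes the position of the curve. *)
Lemma normalize_closed : exists f : R * R -> R * R,
  [/\ motion f, closed_stationary (move f G),
      forall i, transition (move f G) i = transition G i,
      forall i, weight (move f G) i = weight G i
    & tangent (move f G) 1 = e2 /\ (vtx (move f G) 1).1 = 0].
Proof.
have [k hk] : exists k, iter k (@rot90 R) (tangent G 1) = e2.
  case: cs => _ _ _ /(_ 1)[_ ax _ _]; case: ax => ->.
  - by exists 1%N; congr (_, _); rewrite /= oppr0.
  - by exists 3%N; rewrite /= rot90K rot90N opprK; congr (_, _); rewrite /= oppr0.
  - by exists 0%N.
  - by exists 2%N; rewrite /= rot90K opprK.
have [f [mf csf cE wE tE]] := rotate_closed k.
pose v : R * R := (- (f (vtx G 1)).1, 0).
pose g : R * R -> R * R := fun x => x + v.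
have eE i : edge (move (g \o f) G) i = id (edge (move f G) (i + 0)).
  by rewrite addr0; apply: (edge_move_translation (move f G) v).
exists (g \o f); split.
- by apply: motion_comp => //; apply: motion_translation.
- apply: (closed_stationary_transport idE eE) => // i.
  by case: csf => _ _ per _; rewrite /= -[f _]/(vtx (move f G) _) per.
- by move=> i; rewrite (transition_transport_closed idE eE) // addr0.
- by move=> i; rewrite (weight_transport_closed idE eE) // addr0.
- split; first by rewrite (tangent_transport idE eE) addr0 tE.
  by rewrite /= subrr.
Qed.

End RelabelMove.

Section Recurrence.
Variable G : polycurve R.
Hypothesis (alpha_gt0 : 0 < alpha).
Hypothesis cs : closed_stationary G.

Lemma closed_halfline i : halfline G i = false.
Proof. by case: cs => cl _ _ _; rewrite halfline_closed. Qed.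

Lemma closed_len_gt0 i : 0 < len G i.
Proof. by case: cs => _ _ _ /(_ i)[]. Qed.

Lemma closed_axis i : axis (tangent G i).
Proof. by case: cs => _ _ _ /(_ i)[]. Qed.

Lemma closed_weight_eq0 i : (weight G i == 0) = (transition G i == 0).
Proof. by rewrite weight_eq0 // closed_len_gt0. Qed.

Lemma closed_step i :
  weight G (i + 2) = step (2 * alpha)^-1 (weight G i) (weight G (i + 1)).
Proof.
have hl : ~~ halfline G (i + 1) by rewrite closed_halfline.
case: cs => _ _ _ /(_ (i + 1))[_ _ _ /(stationary_atP alpha_gt0 hl)].
by rewrite /step closed_weight_eq0 addrK -addrA.
Qed.

Lemma closed_tangent i : tangent G (i + 1) = turn (left_turn G (i + 1)) (tangent G i).
Proof.
case: cs => _ _ _ /(_ (i + 1))[_ ax dt _]; rewrite addrK in dt.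
have [b hb] := orthogonal_axis (closed_axis i) ax dt.
by rewrite (@left_turn_turn _ G (i + 1) b) ?addrK //; apply/axis_unit/closed_axis.
Qed.

Lemma closed_vtx i : vtx G (i + 1) = vtx G i + scale (len G i) (tangent G i).
Proof. by rewrite -edgeE ?closed_len_gt0 // /edge addrCA subrr addr0. Qed.

Lemma closed_weight_pat (w : nat -> R) :
  (forall k, w k.+2 = step (2 * alpha)^-1 (w k) (w k.+1)) ->
  forall j, weight G j = w 0 -> weight G (j + 1) = w 1%N ->
  forall k : nat, weight G (j + k%:Z) = w k.
Proof.
move=> hw j w0 w1 k.
apply: (@step_unique _ _ k (fun k => weight G (j + k%:Z))) hw _ _ _ _ => //.
- move=> p _ /=; rewrite (_ : j + p.+2%:Z = j + p%:Z + 2) ?closed_step; last by lia.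
  by rewrite (_ : j + p%:Z + 1 = j + p.+1%:Z) //; lia.
- by rewrite addr0.
Qed.

(* The displacement has constant sign along the direction of travel, so that a
   staircase cannot close up. *)
Lemma closed_not_staircase : ~ forall i, transition G i = 0.
Proof.
(* Opposite turns alternate, so the tangents alternate between these two orthogonal unit vectors,
   and each has product 1 with [D]. *)
move=> c0; pose D := tangent G 0 + tangent G 1.
have T2 i : tangent G (i + 2) = tangent G i.
  rewrite (_ : i + 2 = i + 1 + 1) ?closed_tangent; last by lia.
  rewrite (transition_eq0 _ (c0 (i + 1))) ?closed_halfline //.
  case: (left_turn G (i + 1)) => /=; first by rewrite rot90K opprK.
  by rewrite rot90N rot90K opprK.
have t01 : dot (tangent G 0) (tangent G 1) = 0.
  by rewrite (closed_tangent 0 : tangent G 1 = _) dot_turn.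
have TD (k : nat) : dot (tangent G k) D = 1.
  elim/ltn_ind: k => -[|[|k]] IH.
  - by rewrite /D dotDr t01 addr0; apply/axis_unit/closed_axis.
  - rewrite /D dotDr dotC t01 add0r; apply/axis_unit/closed_axis.
  - by rewrite (_ : k.+2%:Z = k%:Z + 2) ?T2 ?IH //; lia.
have hgt (k : nat) : dot (vtx G 0) D <= dot (vtx G k) D.
  elim: k => [//|k IH]; apply: (le_trans IH).
  rewrite (_ : k.+1%:Z = k%:Z + 1) ?closed_vtx; last by lia.
  have := closed_len_gt0 k; have := TD k; rewrite /dot /=; nra.
(* [hgt] is a weak inequality; strictness comes from the last edge of the period, which leads back
   to [vtx G 0]. *)
case: (cs) => _ n0 per _; have := hgt (nseg G).-1; apply/negP; rewrite -ltNge.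
rewrite -[X in _ < dot X _]per add0r.
rewrite (_ : (nseg G)%:Z = (nseg G).-1%:Z + 1) ?closed_vtx; last by lia.
have := closed_len_gt0 (nseg G).-1; have := TD (nseg G).-1.
by rewrite /dot /=; nra.
Qed.

(** If no zero transition number were followed by a nonzero one, zeros would propagate forwards and,
    by periodicity, to all indices. This third case is the staircase, excluded above. *)
Lemma closed_trichotomy :
  (forall i, transition G i != 0) \/
  exists j, transition G j = 0 /\ transition G (j + 1) != 0.
Proof.
apply: contrapT => /not_orP[h1 h2].
have up j : transition G j = 0 -> forall k : nat, transition G (j + k%:Z) = 0.
  move=> j0; elim=> [|k IH]; first by rewrite addr0.
  apply/eqP/negPn/negP => h; apply: h2; exists (j + k%:Z); split=> //.
  by rewrite (_ : _ + 1 = j + k.+1%:Z) //; lia.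
apply: closed_not_staircase => i; apply: contrapT => ci; apply: h1 => j.
apply/negP => /eqP cj; apply: ci; case: (cs) => cl n0 per _.
(* As the period is at least 1, this many periods move [i] past [j]. *)
pose q : int := absz (j - i).
rewrite -(@transition_periodic G q cl per i).
pose p : int := i + q * (nseg G)%:Z - j.
have p0 : 0 <= p by rewrite /p /q; nia.
rewrite (_ : _ + _ = j + (absz p)%:Z) ?up //.
by rewrite gez0_abs // [RHS]addrC subrK.
Qed.

End Recurrence.
End ClosedCurves.

(** * The square *)

Section WulffBoundary.
Variable R : realType.
Implicit Types (x y z : R * R) (r : R).

Lemma scaleE r x : scale r x = r *: x.
Proof. by []. Qed.

Lemma phiE x : phi x = `|x|.
Proof. by []. Qed.

(** [phi] is the norm of the product space [R * R], so closure and interior of a Wulff shape are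
    those of a ball. *)
Lemma wulff_shapeE r z : 0 < r -> wulff_shape r z = closed_ball z r.
Proof.
move=> r0; rewrite closed_ballE // /closed_ball_.
apply/seteqP; split=> x.
- move=> [w hw <-] /=.
  have -> : z - (z + scale r w) = r *: (- w).
    by rewrite opprD addrA subrr add0r scalerN.
  by rewrite normrZ normrN gtr0_norm // -ler_pdivlMl // mulVf ?lt0r_neq0.
- move=> /= hx; exists (r^-1 *: (x - z)); last first.
    rewrite scaleE scalerA mulfV ?lt0r_neq0 // scale1r.
    by rewrite addrC subrK.
  by rewrite /wulff /= phiE normrZ gtr0_norm ?invr_gt0 // distrC ler_pdivrMl // mulr1.
Qed.

Lemma boundary_wulff_shape r z : 0 < r ->
  boundary (wulff_shape r z) = [set x | phi (x - z) = r].
Proof.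
move=> r0; rewrite wulff_shapeE // /boundary.
rewrite -(closure_id _).1; last exact: closed_ball_closed.
rewrite interior_closed_ballE // closed_ballE // -ball_normE.
apply/seteqP; split=> x /=; rewrite (_ : phi (x - z) = `|z - x|) ?phiE ?(distrC x) //.
- move=> [h1 /negP h2]; apply/eqP; rewrite eq_le; apply/andP; split.
    exact: h1.
  by rewrite leNgt; exact: h2.
- move=> h; split; first by rewrite /closed_ball_ /= h.
  by rewrite h ltxx.
Qed.

(** A side of the square of radius [r] about the origin: [x] is its direction, [turn b x] its inner
    normal, and [q] runs from end to end. *)
Lemma phi_axis_comb (b : bool) q r x : axis x -> `|q| <= 1 -> 0 < r ->
  phi (scale r (scale q x - turn b x)) = r.
Proof.
move=> ax q1 r0; rewrite phiE scaleE normrZ.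
rewrite gtr0_norm // -[RHS]mulr1; congr (_ * _).
rewrite -phiE /phi; case: b ax => -[] -> /=;
  rewrite ?(mulr0, mulr1, mulrN1, oppr0, opprK, add0r, subr0, addr0, normrN, normr1, normrN1);
  by [apply: max_r | apply: max_l].
Qed.

(** Conversely, a boundary point lies on a side. The vector [y] is the inner normal of that side,
    found from a coordinate of modulus [r]; [u] is either direction along the side. *)
Lemma phi_eq_axis_comb r x : 0 < r -> phi x = r -> exists y, axis y /\
  forall u b, y = turn b u -> axis u ->
    exists q, `|q| <= 1 /\ x = scale r (scale q u - y).
Proof.
move=> r0 hx.
have [x1 x2] : `|x.1| <= r /\ `|x.2| <= r.
  by rewrite -hx /phi !le_max !lexx orbT.
have hq s : `|s| <= r -> `|s / r| <= 1.
  by move=> h; rewrite normrM normfV (gtr0_norm r0) ler_pdivrMr // mul1r.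
have rr s : r * (s / r) = s by rewrite mulrC divfK // lt0r_neq0.
have [y [ay hy]] : exists y, axis y /\ dot x y = - r.
  have : `|x.1| = r \/ `|x.2| = r.
    by move: hx; rewrite /phi; case: leP => _; [right | left].
  case=> /eqP; rewrite eqr_norml (ltW r0) andbT => /orP[] /eqP h.
  - by exists (- e1); split; [apply: Or42 | rewrite /dot /= h; ring].
  - by exists e1; split; [apply: Or41 | rewrite /dot /= h; ring].
  - by exists (- e2); split; [apply: Or44 | rewrite /dot /= h; ring].
  - by exists e2; split; [apply: Or43 | rewrite /dot /= h; ring].
exists y; split=> // u b yE au; exists (dot x u / r); split.
  apply: hq; case: au => -> /=; rewrite /dot /= ?oppr0 ?mulr0 ?mulrN1 ?mulr1;
  by rewrite ?(addr0, add0r, normrN).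
move: hy; rewrite {}yE; case: x {x1 x2 hx} => p q.
case: b au => -[] ->; rewrite /dot /turn /= => hy; congr (_, _);
  rewrite /= ?(mulrN1, mulr1, mulr0, oppr0, addr0, add0r) ?mulrDr ?mulrN ?opprK ?rr;
  by move: hy; lra.
Qed.

Lemma axis_four b x y : axis x -> axis y ->
  [\/ y = x, y = turn b x, y = - x | y = - turn b x].
Proof.
case: b => -[] -> [] ->; rewrite ?opprK;
  first [ by apply: Or41; congr (_, _) => /=; lra
        | by apply: Or42; congr (_, _) => /=; lra
        | by apply: Or43; congr (_, _) => /=; lra
        | by apply: Or44; congr (_, _) => /=; lra ].
Qed.

End WulffBoundary.

Section ClosedSquare.
Variables (R : realType) (alpha : R) (G : polycurve R).
Hypotheses (alpha_gt0 : 0 < alpha) (cs : closed_stationary alpha G).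
Hypothesis c_neq0 : forall i, transition G i != 0.
Let K : R := (2 * alpha)^-1.

Let w_neq0 i : (weight G i == 0) = false.
Proof. by rewrite (closed_weight_eq0 cs) (negbTE (c_neq0 i)). Qed.

Let w2 i : weight G (i + 2) = K - weight G i.
Proof. by rewrite (closed_step alpha_gt0 cs) /step w_neq0. Qed.

Let leftE i : left_turn G (i + 1) = left_turn G i.
Proof. by have [] := transition_neq0 (c_neq0 i). Qed.

Let T11 i : tangent G (i + 1 + 1) = - tangent G i.
Proof.
rewrite !(closed_tangent cs) leftE.
by case: left_turn; rewrite /= ?rot90N rot90K ?opprK.
Qed.

Let T2 i : tangent G (i + 2) = - tangent G i.
Proof. by rewrite -T11 -addrA. Qed.

Let T4 i : tangent G (i + 4) = tangent G i.
Proof. by rewrite (_ : i + 4 = i + 2 + 2) ?T2 ?opprK //; lia. Qed.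

Let len4 i : len G (i + 4) = len G i.
Proof.
have : weight G (i + 4) = weight G i.
  by rewrite (_ : i + 4 = i + 2 + 2) ?w2 ?subKr //; lia.
rewrite !weight_neq0 // => /invr_inj/eqP.
by rewrite eqrXn2 ?ltW ?(closed_len_gt0 cs) // => /eqP.
Qed.

(** Four consecutive edges move the curve by [len G i - len G (i + 2)] in the direction
    [tangent G i], and every block of four repeats this. *)
Let len2 i : len G (i + 2) = len G i.
Proof.
pose f (k : nat) := dot (tangent G i) (vtx G (i + 4 * k%:Z)).
have P4 j : vtx G (j + 4) = vtx G j + scale (len G j) (tangent G j)
    + scale (len G (j + 1)) (tangent G (j + 1))
    - scale (len G (j + 2)) (tangent G j)
    - scale (len G (j + 3)) (tangent G (j + 1)).
  rewrite (_ : j + 4 = j + 1 + 1 + 1 + 1); last by lia.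
  rewrite (_ : j + 3 = j + 1 + 1 + 1); last by lia.
  rewrite (_ : j + 2 = j + 1 + 1); last by lia.
  by rewrite !(closed_vtx cs) !T11 !scaleN.
have Tk (k : nat) : tangent G (i + 4 * k%:Z) = tangent G i.
  elim: k => [|k IH]; first by rewrite mulr0 addr0.
  by rewrite (_ : _ + _ = i + 4 * k%:Z + 4) ?T4 //; lia.
have lk (k : nat) j : len G (j + 4 * k%:Z) = len G j.
  elim: k => [|k IH]; first by rewrite mulr0 addr0.
  by rewrite (_ : _ + _ = j + 4 * k%:Z + 4) ?len4 //; lia.
have fS k : f k.+1 = f k + (len G i - len G (i + 2)).
  rewrite /f (_ : i + 4 * k.+1%:Z = i + 4 * k%:Z + 4); last by lia.
  rewrite P4 !dotDr !dotNr !(dotZr (len _ _)) (closed_tangent cs) Tk dot_turn.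
  rewrite (axis_unit (closed_axis cs _)) -(addrAC _ 2) !lk.
  by ring.
have fE k : f k = f 0 + k%:R * (len G i - len G (i + 2)).
  by elim: k => [|k IH]; [rewrite mul0r addr0 | rewrite fS IH -natr1; ring].
(* [nseg G] blocks of four edges are exactly four periods, so it need not be shown that 4 divides
   [nseg G]. *)
have := fE (nseg G); case: (cs) => _ n0 per _.
rewrite {1}/f (vtx_periodic 4 i per) /f mulr0 addr0.
have n1 : (nseg G)%:R != 0 :> R by rewrite pnatr_eq0 -lt0n.
move=> /eqP; rewrite -subr_eq0 opprD addrA subrr add0r oppr_eq0 mulf_eq0.
by rewrite (negbTE n1) subr_eq0 => /eqP.
Qed.

Let a4 : Num.sqrt (4 * alpha) = 2 * Num.sqrt alpha.
Proof.
rewrite sqrtrM //; congr (_ * _).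
by rewrite (_ : 4 = 2 ^+ 2) ?sqrtr_sqr ?gtr0_norm // -natrX.
Qed.

Let lenE i : len G i = Num.sqrt (4 * alpha).
Proof.
have a0 : alpha != 0 by rewrite lt0r_neq0.
(* Weights two apart are now equal and add up to [K]. *)
have h : weight G i = K / 2.
  have := w2 i; rewrite !weight_neq0 // len2; lra.
apply: len_weight; rewrite ?(closed_len_gt0 cs) ?h //.
  by rewrite /K; field.
by rewrite mulf_neq0 ?pnatr_eq0.
Qed.

Lemma closed_square : square alpha G.
Proof.
split=> // ; case: (cs) => cl n0 per _.
set r := Num.sqrt alpha; have r0 : 0 < r by rewrite sqrtr_gt0.
(* The centre: half a side, which is [r], along each of the two sides that meet at the end of
   [S_0]. *)
pose z := vtx G 0 + scale r (tangent G 0 + tangent G 1).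
have center (k : nat) : vtx G k = z - scale r (tangent G k + tangent G (k%:Z + 1)).
  elim: k => [|k IH]; first by rewrite /z addrK.
  rewrite (_ : k.+1%:Z = k%:Z + 1) ?(closed_vtx cs) ?IH ?lenE ?a4; last by lia.
  rewrite -[k%:Z + 1 + 1]addrA T2; apply/eqP; rewrite -subr_eq0; apply/eqP.
  by congr (_, _); rewrite /= -/r; ring.
(* The side is parametrized from its midpoint, which is the centre minus [r] times the next tangent;
   [q] is [2 * s - 1]. *)
have segE (k : nat) : segment G k = [set x | exists q, `|q| <= 1 /\
    x = z + scale r (scale q (tangent G k) - turn (left_turn G (k%:Z + 1)) (tangent G k))].
  have eE : edge G k = scale (2 * r) (tangent G k).
    by rewrite edgeE ?(closed_len_gt0 cs) // lenE a4.
  rewrite -(closed_tangent cs); apply/seteqP; split=> x /=.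
  - move=> [s [h0 h1 ->]]; move: h0 h1.
    rewrite /first_halfline /last_halfline cl /= => -[//|s0] [//|s1].
    exists (2 * s - 1); split; first by rewrite ler_norml; lra.
    rewrite center eE; move: (z) (tangent G k) (tangent G (k%:Z + 1)) => p t u.
    by congr (_, _); rewrite /=; ring.
  - move=> [q [q1 ->]]; exists ((q + 1) / 2).
    move: q1; rewrite ler_norml => /andP[q0 q1].
    split; [by right; lra | by right; lra |].
    rewrite center eE; move: (z) (tangent G k) (tangent G (k%:Z + 1)) => p t u.
    by congr (_, _); rewrite /=; field.
exists z; rewrite boundary_wulff_shape //; apply/seteqP; split=> x.
- move=> [i [ir]]; have -> : i = `|i|%N :> int by move: ir; rewrite /in_range; lia.
  rewrite segE => -[q [q1 ->]] /=; rewrite addrAC subrr add0r.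
  by apply: phi_axis_comb => //; apply: closed_axis cs _.
- move=> /= hx; have [y [ay hy]] := phi_eq_axis_comb r0 hx.
  (* The inner normal of a side is the direction of the next segment, and four consecutive tangents
     exhaust the axis directions. *)
  have [j yE] : exists j : int, y = tangent G (j + 1).
    have t1 := closed_tangent cs 0; rewrite add0r in t1.
    case: (axis_four (left_turn G 1) (closed_axis cs 0) ay); rewrite -?t1 => ->.
    + by exists (-1); rewrite addNr.
    + by exists 0; rewrite add0r.
    + by exists 1; rewrite -T2.
    + by exists 2; rewrite -T2.
  have [q ir] := in_range_mod j n0.
  pose i := j + q * (nseg G)%:Z.
  have [k kE] : exists k : nat, i = k.
    by exists (absz i); move: ir; rewrite /in_range -/i; lia.
  have yE' : y = turn (left_turn G (i + 1)) (tangent G i).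
    by rewrite -(closed_tangent cs) /i addrAC (tangent_periodic q per).
  have [p [p1 xE]] := hy _ _ yE' (closed_axis cs _).
  exists i; split=> //; rewrite kE segE -kE; exists p; split=> //.
  by rewrite -yE' -xE addrC subrK.
Qed.

End ClosedSquare.

(** * Closed right-angle chains *)

Lemma scale0v (R : realType) (x : R * R) : scale 0 x = 0.
Proof. by congr (_, _); rewrite mul0r. Qed.

Section ClosingRightAngles.
Variables (R : realType) (P T : nat -> R * R) (l : nat -> R) (b : nat -> bool).
Variables (s : R) (m : nat).
Hypothesis P_succ : forall k, P k.+1 = P k + scale (l k) (T k).
Hypothesis T_succ : forall k, T k.+1 = turn (b k.+1) (T k).
Hypothesis b_pat : forall k, (k < 2 * m)%N ->
  [/\ b (3 * k + 2) = b (3 * k + 1), b (3 * k + 3) = b (3 * k + 1)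
    & b (3 * k + 4) = ~~ b (3 * k + 1)]%N.
Hypothesis l_pat : forall k, (k < 2 * m)%N ->
  l (3 * k + 1)%N = s /\ l (3 * k + 2)%N = s.

(* Two consecutive right-angles of opposite signs form a period of the tangent. *)
Lemma right_angle_chain_endpoint q : (q <= m)%N ->
  [/\ T (6 * q)%N = T 0%N, b (6 * q + 1)%N = b 1%N
    & P (6 * q)%N = P 0%N
        + scale (\sum_(0 <= k < q) l (6 * k)%N - 2 * q%:R * s) (T 0%N)
        + scale (2 * q%:R * s - \sum_(0 <= k < q) l (6 * k + 3)%N) (T 1%N)].
Proof.
elim: q => [|q IH] qm.
  rewrite muln0; split=> //; rewrite !big_geq //.
  by rewrite mulr0 mul0r subrr !scale0v !addr0.
have [Tq bq Pq] := IH (ltnW qm).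
have k1 : (2 * q < 2 * m)%N by lia.
have k2 : ((2 * q).+1 < 2 * m)%N by lia.
have [b1 b2 b3] := b_pat k1; have [l1 l2] := l_pat k1.
have [b4 b5 b6] := b_pat k2; have [l4 l5] := l_pat k2.
move: b1 b2 b3 b4 b5 b6 l1 l2 l4 l5.
rewrite (_ : 3 * (2 * q) + 1 = 6 * q + 1)%N; last by lia.
rewrite (_ : 3 * (2 * q) + 2 = (6 * q).+2)%N; last by lia.
rewrite (_ : 3 * (2 * q) + 3 = (6 * q).+3)%N; last by lia.
rewrite (_ : 3 * (2 * q) + 4 = (6 * q).+4)%N; last by lia.
rewrite (_ : 3 * (2 * q).+1 + 1 = (6 * q).+4)%N; last by lia.
rewrite (_ : 3 * (2 * q).+1 + 2 = (6 * q).+4.+1)%N; last by lia.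
rewrite (_ : 3 * (2 * q).+1 + 3 = (6 * q).+4.+2)%N; last by lia.
rewrite (_ : 3 * (2 * q).+1 + 4 = (6 * q).+4.+3)%N; last by lia.
rewrite (_ : 6 * q.+1 + 1 = (6 * q).+4.+3)%N; last by lia.
rewrite (_ : 6 * q.+1 = (6 * q).+4.+2)%N; last by lia.
rewrite !bq => b1 b2 b3 b4 b5 b6 l1 l2 l4 l5.
rewrite addn1 in bq l1.
have qS : q.+1%:R = q%:R + 1 :> R by rewrite natr1.
rewrite !big_nat_recr //= !addn3 qS !P_succ Pq !T_succ Tq.
rewrite !(b6, b5, b4, b3, b2, b1, bq, l1, l2, l4, l5) negbK.
move: (P 0%N) (T 0%N) (l _) (l _) (\sum_(0 <= k < q) _) (\sum_(0 <= k < q) _).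
move=> [p1 p2] [t1 t2] l0 l3 S0 S3.
by case: (b 1%N); split=> //; congr (_, _) => /=; ring.
Qed.

Hypothesis T_axis : axis (T 0%N).

(** [T 0] and [T 1] are orthogonal, so both coefficients of the displacement vanish. The statement
    is about bare sequences because it serves both for a given curve and for constructing one, where
    closing has to be known before there is a closed curve. *)
Lemma right_angle_chain_closing : P (6 * m)%N = P 0%N <->
  \sum_(0 <= k < m) l (6 * k)%N = 2 * m%:R * s /\
  \sum_(0 <= k < m) l (6 * k + 3)%N = 2 * m%:R * s.
Proof.
have [_ _ ->] := right_angle_chain_endpoint (leqnn m).
set S0 := \sum_(_ <= _ < _) _; set S3 := \sum_(_ <= _ < _) _.
split=> [|[-> ->]]; last by rewrite !subrr !scale0v !addr0.
rewrite -[RHS]addr0 -addrA T_succ => /addrI h.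
have h1 : (scale (S0 - 2 * m%:R * s) (T 0%N) +
  scale (2 * m%:R * s - S3) (turn (b 1%N) (T 0%N))).1 = 0 by rewrite h.
have h2 : (scale (S0 - 2 * m%:R * s) (T 0%N) +
  scale (2 * m%:R * s - S3) (turn (b 1%N) (T 0%N))).2 = 0 by rewrite h.
move: h1 h2; case: T_axis => ->; case: (b 1%N) => /=; lra.
Qed.

End ClosingRightAngles.

Section EvenOddSums.
Variables (R : realType) (F : nat -> R).

(** The free lengths are those of the [S_(3k)]. Odd [k] gives the segments [S_(6j+3)], even [k] the
    [S_(6j)] with [j > 0]; these two families enter different closing conditions. *)
Lemma sum_odd m : (0 < m)%N ->
  \sum_(1 <= k < 2 * m | odd k) F k = \sum_(0 <= k < m) F (2 * k + 1)%N.
Proof.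
elim: m => [//|[_ _|m IH _]]; first by rewrite unlock /= !addr0.
rewrite [RHS]big_nat_recr //= -IH // (_ : 2 * m.+2 = (2 * m.+1).+2)%N; last by lia.
have -> : F (2 * m.+1 + 1)%N = F (2 * m.+1).+1 by rewrite addn1.
have : odd (2 * m.+1) = false by rewrite oddM.
have : (0 < 2 * m.+1)%N by lia.
move: (2 * m.+1)%N => M M0 oM; rewrite !(big_mkcond odd).
by rewrite !big_nat_recr //= ?oM /= ?addr0 //; lia.
Qed.

Lemma sum_even m : (0 < m)%N ->
  \sum_(1 <= k < 2 * m | ~~ odd k) F k = \sum_(1 <= k < m) F (2 * k)%N.
Proof.
elim: m => [//|[_ _|m IH _]]; first by rewrite unlock /=.
rewrite [RHS]big_nat_recr //= -IH // (_ : 2 * m.+2 = (2 * m.+1).+2)%N; last by lia.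
have : odd (2 * m.+1) = false by rewrite oddM.
have : (0 < 2 * m.+1)%N by lia.
move: (2 * m.+1)%N => M M0 oM; rewrite !(big_mkcond (fun k => ~~ odd k)).
by rewrite !big_nat_recr //= ?oM /= ?addr0 //; lia.
Qed.

End EvenOddSums.

Section LeftTurnPattern.
Variables (R : realType) (alpha : R) (G : polycurve R).
Hypothesis cs : closed_stationary alpha G.

Lemma closed_left_turn_eq (k : nat) : transition G k != 0 ->
  left_turn G k.+1 = left_turn G k.
Proof. by move=> /transition_neq0[-> _]; congr left_turn; lia. Qed.

Lemma closed_left_turn_neq (k : nat) : transition G k = 0 ->
  left_turn G k.+1 = ~~ left_turn G k.
Proof.
move=> h; rewrite -(transition_eq0 _ h) ?(closed_halfline cs) //.
by congr left_turn; lia.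
Qed.

Lemma closed_tangent_succ (k : nat) :
  tangent G k.+1 = turn (left_turn G k.+1) (tangent G k).
Proof.
by have := closed_tangent cs k; rewrite (_ : k%:Z + 1 = k.+1) //; lia.
Qed.

Lemma closed_vtx_succ (k : nat) :
  vtx G k.+1 = vtx G k + scale (len G k) (tangent G k).
Proof. by have := closed_vtx cs k; rewrite (_ : k%:Z + 1 = k.+1) //; lia. Qed.

Lemma closed_period_vtx (k : nat) : vtx G (k + nseg G)%N = vtx G k.
Proof. by case: cs => _ _ per _; rewrite PoszD per. Qed.

Lemma closed_period_len (k : nat) : len G (k + nseg G)%N = len G k.
Proof.
by case: cs => _ _ per _; rewrite -(len_periodic 1 per k) mul1r PoszD.
Qed.

Lemma closed_period_transition (k : nat) :
  transition G (k + nseg G)%N = transition G k.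
Proof.
case: cs => cl _ per _.
by rewrite -(@transition_periodic _ _ 1 cl per k) mul1r PoszD.
Qed.

Lemma closed_right_angles_closing m s : nseg G = (6 * m)%N ->
  (forall k, (k < 2 * m)%N ->
     [/\ transition G (3 * k + 1)%N != 0, transition G (3 * k + 2)%N != 0
       & transition G (3 * k + 3)%N = 0]) ->
  (forall k, (k < 2 * m)%N ->
     len G (3 * k + 1)%N = s /\ len G (3 * k + 2)%N = s) ->
  \sum_(0 <= k < m) len G (6 * k)%N = 2 * m%:R * s /\
  \sum_(0 <= k < m) len G (6 * k + 3)%N = 2 * m%:R * s.
Proof.
move=> nE hc hl.
apply/(@right_angle_chain_closing _ (fun k => vtx G k) (fun k => tangent G k)
  (fun k => len G k) (fun k => left_turn G k) s m) => //.
- exact: closed_vtx_succ.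
- exact: closed_tangent_succ.
- move=> k /hc[a1 a2 a3]; rewrite !addnS addn0 in a1 a2 a3 *.
  by rewrite (closed_left_turn_neq a3) (closed_left_turn_eq a2) (closed_left_turn_eq a1).
- exact: closed_axis cs _.
- by rewrite -nE -[nseg G]add0n closed_period_vtx.
Qed.

End LeftTurnPattern.

Section ClosedRightAngles.
Variables (R : realType) (alpha : R) (G : polycurve R).
Hypotheses (alpha_gt0 : 0 < alpha) (cs : closed_stationary alpha G).
Hypotheses (c0 : transition G 0 = 0) (c1 : transition G 1 != 0).
Let K : R := (2 * alpha)^-1.

Let K_neq0 : K != 0.
Proof. by rewrite invr_neq0 // mulf_neq0 // lt0r_neq0. Qed.

Lemma closed_right_angles : weight G 3 = 0 ->
  exists m, (1 <= m)%N /\ closed_right_angle_chain alpha m G.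
Proof.
move=> w3.
have w0 : weight G 0 = 0 by apply/eqP; rewrite (closed_weight_eq0 cs) c0.
have w1 : (weight G 1 == 0) = false by rewrite (closed_weight_eq0 cs) (negbTE c1).
have w2 : weight G 2 = K.
  by have := closed_step alpha_gt0 cs 0; rewrite !add0r /step w1 w0 subr0.
have w1K : weight G 1 = K.
  have := closed_step alpha_gt0 cs 1; rewrite -[1 + 1]/2 -[1 + 2]/3 w2 w3 /step.
  by rewrite (negbTE K_neq0) => /eqP; rewrite eq_sym subr_eq0 => /eqP.
have wE (k : nat) : weight G k = pat3 K k.
  by have := closed_weight_pat alpha_gt0 cs (fun k => pat3_step k K_neq0) w0 w1K k;
    rewrite add0r.
have cE (k : nat) : (transition G k == 0) = (3 %| k)%N.
  rewrite -(closed_weight_eq0 cs) wE /pat3; case: ifP; rewrite ?eqxx //.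
  by rewrite (negbTE K_neq0).
have lE (k : nat) : ~~ (3 %| k)%N -> len G k = Num.sqrt (2 * alpha).
  move=> k3; apply: len_weight; first exact: closed_len_gt0 cs _.
    by rewrite wE /pat3 (negbTE k3).
  by rewrite mulf_neq0 // lt0r_neq0.
have h1 k : transition G (3 * k + 1)%N != 0 by rewrite cE; lia.
have h2 k : transition G (3 * k + 2)%N != 0 by rewrite cE; lia.
have h3 k : transition G (3 * k + 3)%N = 0 by apply/eqP; rewrite cE; lia.
have leftS k : left_turn G (3 * k + 4)%N = ~~ left_turn G (3 * k + 1)%N.
  have [a1 a2 a3] := And3 (h1 k) (h2 k) (h3 k); rewrite !addnS addn0 in a1 a2 a3 *.
  by rewrite (closed_left_turn_neq cs a3) (closed_left_turn_eq a2) (closed_left_turn_eq a1).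
have leftE k : left_turn G (3 * k + 1)%N = odd k (+) left_turn G 1.
  elim: k => [//|k IH]; rewrite (_ : 3 * k.+1 + 1 = 3 * k + 4)%N; last by lia.
  by rewrite leftS IH oddS addNb.
have /dvdnP[N nE] : (3 %| nseg G)%N.
  by rewrite -cE -[nseg G]add0n (closed_period_transition cs) c0.
have N_even : odd N = false.
  have : left_turn G (3 * N + 1)%N = left_turn G 1.
    have := closed_period_transition cs 1.
    rewrite (_ : 1 + nseg G = 3 * N + 1)%N; last by lia.
    have [_ ->] := transition_neq0 (h1 N); have [_ ->] := transition_neq0 c1.
    by do 2!case: left_turn.
  by rewrite leftE; case: (odd N); case: left_turn.
have [m Nm] : exists m, N = (2 * m)%N by exists (N./2); lia.
have nm : nseg G = (6 * m)%N by lia.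
have m_gt0 : (0 < m)%N by case: cs; lia.
exists m; split=> //; split=> //.
- move=> k _; split; last 2 first.
  + by apply: lE; lia.
  + by apply: lE; lia.
  split.
  + by apply/eqP; rewrite (_ : _ - 1 = (3 * k)%N :> int) ?cE; lia.
  + by apply: transition_mul_succ => //; rewrite (_ : _ + 1 = (3 * k + 2)%N :> int) //; lia.
  + by rewrite (_ : _ + 2 = (3 * k + 3)%N :> int) //; lia.
- move=> k _; rewrite /opposite_transition.
  have [_ ->] := transition_neq0 (h1 k); have [_ ->] := transition_neq0 (h1 k.+1).
  by rewrite !leftE oddS; case: (odd k); case: left_turn.
- move=> [//|k] _; have c3 : transition G (3 * k.+1)%N = 0.
    by rewrite (_ : 3 * k.+1 = 3 * k + 3)%N //; lia.
  by split=> //; rewrite /phi_curvature c3 mulr0 mul0r; case: ifP.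
(* For [m = 1] each closing sum has a single term, and [S_0] is [S_6]. *)
- move=> m1; have := closed_right_angles_closing cs nm (fun k _ => And3 (h1 k) (h2 k) (h3 k))
    (fun k _ => conj (lE _ _) (lE _ _)).
  move=> /(_ ltac:(lia) ltac:(lia)).
  rewrite m1 !big_nat1 mulr1 => -[l0 l3]; split=> //.
  by rewrite -l0 -(closed_period_len cs) nm m1.
Qed.

End ClosedRightAngles.

(** * Closed double-right-angle chains *)

Lemma card_odd_ord m : #|[set k : 'I_(2 * m) | odd k]%SET| = m.
Proof.
rewrite -sum1_card (eq_bigl (fun k : 'I_(2 * m) => odd k)); last first.
  by move=> k; rewrite inE.
rewrite -(big_mkord odd (fun=> 1%N)).
elim: m => [|m IH]; first by rewrite muln0 big_geq.
rewrite (_ : 2 * m.+1 = (2 * m).+2)%N; last by lia.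
move: IH; have : odd (2 * m) = false by rewrite oddM.
move: (2 * m)%N => M oM; rewrite !(big_mkcond odd) => IH.
by rewrite !big_nat_recr //= oM /= IH; lia.
Qed.

Section ClosedDoubleRightAngles.
Variables (R : realType) (alpha : R) (G : polycurve R).
Hypotheses (alpha_gt0 : 0 < alpha) (cs : closed_stationary alpha G).
Hypotheses (c1 : transition G 1 = 0) (c2 : transition G 2 != 0).
Hypothesis w4 : weight G 4 != 0.
Hypotheses (T1 : tangent G 1 = e2) (x1 : (vtx G 1).1 = 0).
Let K : R := (2 * alpha)^-1.

Let K_neq0 : K != 0.
Proof. by rewrite invr_neq0 // mulf_neq0 // lt0r_neq0. Qed.

Let w1 : weight G 1 = 0.
Proof. by apply/eqP; rewrite (closed_weight_eq0 cs) c1. Qed.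

Let w2 : (weight G 2 == 0) = false.
Proof. by rewrite (closed_weight_eq0 cs) (negbTE c2). Qed.

Let w3 : weight G 3 = K.
Proof.
have := closed_step alpha_gt0 cs 1; rewrite -[1 + 2]/3 -[1 + 1]/2.
by rewrite w1 /step w2 subr0.
Qed.

Let w4E : weight G 4 = K - weight G 2.
Proof.
have -> : weight G 4 = step K (weight G 2) (weight G 3).
  exact: closed_step alpha_gt0 cs 2.
by rewrite w3 /step (negbTE K_neq0).
Qed.

Let A : R := weight G 2.

Let wE (k : nat) : weight G k.+1 = pat4 K A k.
Proof.
have A0 : A != 0 by rewrite /A w2.
have B0 : K - A != 0 by rewrite -w4E.
have := closed_weight_pat alpha_gt0 cs (fun k => pat4_step k K_neq0 A0 B0) w1 erefl k.
by rewrite (_ : 1 + k%:Z = k.+1) //; lia.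
Qed.

Let cE (k : nat) : (transition G k.+1 == 0) = (4 %| k)%N.
Proof.
rewrite -(closed_weight_eq0 cs) wE /pat4 /dvdn -(@modn_dvdm 8 k 4) // /A.
have := ltn_pmod k (isT : (0 < 8)%N).
by case: (k %% 8)%N => [|[|[|[|[|[|[|[|]]]]]]]] //= _;
  rewrite ?eqxx ?(negbTE K_neq0) ?w2 -?w4E ?(negbTE w4).
Qed.

Let h1 k : transition G (4 * k).+1 = 0. Proof. by apply/eqP; rewrite cE; lia. Qed.
Let h2 k : transition G (4 * k).+2 != 0. Proof. by rewrite cE; lia. Qed.
Let h3 k : transition G (4 * k).+3 != 0. Proof. by rewrite cE; lia. Qed.
Let h4 k : transition G (4 * k).+4 != 0. Proof. by rewrite cE; lia. Qed.

Let side k : bool := left_turn G (4 * k).+2.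

Let leftE k : [/\ left_turn G (4 * k).+3 = side k,
  left_turn G (4 * k).+4 = side k & left_turn G (4 * k).+1.+4 = side k].
Proof.
by rewrite (closed_left_turn_eq (h4 k)) (closed_left_turn_eq (h3 k))
  (closed_left_turn_eq (h2 k)).
Qed.

Let sideE k : side k = odd k (+) left_turn G 2.
Proof.
elim: k => [//|k IH]; rewrite oddS addNb -IH /side.
rewrite (_ : (4 * k.+1).+2 = (4 * k).+2.+4)%N; last by lia.
rewrite (closed_left_turn_neq cs); first by case: (leftE k) => _ _ ->.
by rewrite (_ : (4 * k).+1.+4 = (4 * k.+1).+1)%N ?h1 //; lia.
Qed.

(* The common transition number of the k-th double-right-angle, and the sign of
   the abscissa of its vertical side. *)
Let sigma k : R := if side k then - 1 else 1.

(** The four equal turns of a block, left or right, add up to a full turn, so every block starts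
    upwards. *)
Let tangentE k : [/\ tangent G (4 * k).+1 = (0, 1),
  tangent G (4 * k).+2 = (sigma k, 0), tangent G (4 * k).+3 = (0, - 1)
  & tangent G (4 * k).+4 = (- sigma k, 0)].
Proof.
have next j : tangent G (4 * j).+1 = (0, 1) ->
    [/\ tangent G (4 * j).+2 = (sigma j, 0), tangent G (4 * j).+3 = (0, - 1),
        tangent G (4 * j).+4 = (- sigma j, 0) & tangent G (4 * j.+1).+1 = (0, 1)].
  move=> t1; have [l3 l4 l5] := leftE j.
  have t2 : tangent G (4 * j).+2 = (sigma j, 0).
    rewrite (closed_tangent_succ cs) t1 -/(side j) /sigma.
    by case: (side j); congr (_, _); rewrite /= ?oppr0 ?opprK.
  have t3 : tangent G (4 * j).+3 = (0, - 1).
    rewrite (closed_tangent_succ cs) t2 l3 /sigma.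
    by case: (side j); congr (_, _); rewrite /= ?oppr0 ?opprK.
  have t4 : tangent G (4 * j).+4 = (- sigma j, 0).
    rewrite (closed_tangent_succ cs) t3 l4 /sigma.
    by case: (side j); congr (_, _); rewrite /= ?oppr0 ?opprK.
  split=> //; rewrite (_ : (4 * j.+1).+1 = (4 * j).+1.+4)%N; last by lia.
  rewrite (closed_tangent_succ cs) t4 l5 /sigma.
  by case: (side j); congr (_, _); rewrite /= ?oppr0 ?opprK.
have t1 : tangent G (4 * k).+1 = (0, 1).
  by elim: k => [//|k /next[]].
by have [t2 t3 t4 _] := next k t1.
Qed.

Let x k : R := (vtx G k%:Z).1.

Let xE k : [/\ x (4 * k).+2 = x (4 * k).+1,
  x (4 * k).+3 = x (4 * k).+1 + sigma k * len G (4 * k).+2,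
  x (4 * k).+4 = x (4 * k).+1 + sigma k * len G (4 * k).+2
  & x (4 * k.+1).+1 =
      x (4 * k).+1 + sigma k * (len G (4 * k).+2 - len G (4 * k).+4)].
Proof.
have [t1 t2 t3 t4] := tangentE k.
have xS j : x j.+1 = x j + len G j * (tangent G j).1.
  by rewrite /x (closed_vtx_succ cs).
have e2 : x (4 * k).+2 = x (4 * k).+1 by rewrite xS t1 mulr0 addr0.
have e3 : x (4 * k).+3 = x (4 * k).+1 + sigma k * len G (4 * k).+2.
  by rewrite xS t2 e2 mulrC.
have e4 : x (4 * k).+4 = x (4 * k).+1 + sigma k * len G (4 * k).+2.
  by rewrite xS t3 mulr0 addr0.
split=> //; rewrite (_ : (4 * k.+1).+1 = (4 * k).+1.+4)%N; last by lia.
by rewrite xS e4 t4 /=; ring.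
Qed.

Let weight_len j k : weight G j = weight G k -> transition G j != 0 ->
  transition G k != 0 -> len G j = len G k.
Proof.
move=> h cj ck; move: h; rewrite !weight_neq0 // => /invr_inj/eqP.
by rewrite eqrXn2 ?ltW ?(closed_len_gt0 cs) // => /eqP.
Qed.

Let sigmaS k : sigma k.+1 = - sigma k.
Proof.
rewrite /sigma !sideE oddS.
by case: (odd k); case: (left_turn G 2); rewrite ?opprK.
Qed.

Let len_odd k : len G (4 * k.+1).+2 = len G (4 * k).+4 /\
  len G (4 * k.+1).+4 = len G (4 * k).+2.
Proof.
suff : forall j, [/\ weight G (4 * j.+1).+2 = weight G (4 * j).+4 &
                     weight G (4 * j.+1).+4 = weight G (4 * j).+2].
  move=> /(_ k)[h h']; split; apply: weight_len => //; exact: h2 || exact: h4.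
move=> j; have : ((4 * j) %% 8 = 0)%N \/ ((4 * j) %% 8 = 4)%N by lia.
rewrite !wE /pat4; case=> h.
- have -> : ((4 * j.+1).+1 %% 8 = 5)%N by lia.
  have -> : ((4 * j).+3 %% 8 = 3)%N by lia.
  have -> : ((4 * j.+1).+3 %% 8 = 7)%N by lia.
  by have -> : ((4 * j).+1 %% 8 = 1)%N by lia.
- have -> : ((4 * j.+1).+1 %% 8 = 1)%N by lia.
  have -> : ((4 * j).+3 %% 8 = 7)%N by lia.
  have -> : ((4 * j.+1).+3 %% 8 = 3)%N by lia.
  by have -> : ((4 * j).+1 %% 8 = 5)%N by lia.
Qed.

(** From one block to the next [sigma] changes sign and the two lengths are exchanged, so two
    consecutive blocks move the curve by twice the same amount. *)
Let len_eq : len G 2 = len G 4.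
Proof.
have x8 q : x (4 * (2 * q)).+1 = q%:R * (2 * sigma 0 * (len G 2 - len G 4)).
  elim: q => [|q IH]; first by rewrite mul0r /x x1.
  have [_ _ _ e1] := xE (2 * q); have [_ _ _ e2] := xE (2 * q).+1.
  rewrite (_ : 2 * q.+1 = (2 * q).+2)%N ?e2 ?e1 ?IH; last by lia.
  have s0 : sigma (2 * q) = sigma 0.
    by rewrite /sigma !sideE oddM.
  have [l1 l2] := len_odd (2 * q); rewrite sigmaS s0 l1 l2.
  have [l3 l4] : len G (4 * (2 * q)).+2 = len G 2 /\ len G (4 * (2 * q)).+4 = len G 4.
    elim: (q) => [//|p [IH2 IH4]]; rewrite (_ : 2 * p.+1 = (2 * p).+2)%N; last by lia.
    by case: (len_odd (2 * p).+1) => -> ->; case: (len_odd (2 * p)) => -> ->.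
  by rewrite l3 l4 -natr1; ring.
(* [nseg G] pairs of blocks have [8 * nseg G] segments, that is, eight periods. *)
have := x8 (nseg G); case: (cs) => _ n0 per _.
rewrite /x (_ : (4 * (2 * nseg G)).+1%:Z = 1 + 8 * (nseg G)%:Z); last by lia.
rewrite (vtx_periodic _ _ per) x1 => /esym/eqP.
have n1 : (nseg G)%:R != 0 :> R by rewrite pnatr_eq0 -lt0n.
rewrite !mulf_eq0 (negbTE n1) pnatr_eq0 /= subr_eq0.
by rewrite /sigma; case: (side 0); rewrite ?oppr_eq0 oner_eq0 => /eqP.
Qed.

Let width := Num.sqrt (4 * alpha).

Let width_gt0 : 0 < width.
Proof. by rewrite sqrtr_gt0 mulr_gt0. Qed.

Let len_even k : len G (4 * k).+2 = width /\ len G (4 * k).+4 = width.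
Proof.
elim: k => [|k [l2 l4]]; last by have [-> ->] := len_odd k.
rewrite muln0 -len_eq; suff : len G 2 = width by [].
apply: len_weight; first exact: closed_len_gt0 cs _.
  have c4 : transition G 4 != 0 := h4 0.
  have := w4E; rewrite !weight_neq0 // -len_eq => h.
  have -> : len G 2 ^- 2 = K / 2 by lra.
  by rewrite /K; field; rewrite lt0r_neq0.
by rewrite mulf_neq0 ?pnatr_eq0 // lt0r_neq0.
Qed.

Let x_axis k : x (4 * k).+1 = 0.
Proof.
elim: k => [|k IH]; first exact: x1.
have [_ _ _ ->] := xE k; have [-> ->] := len_even k.
by rewrite IH subrr mulr0 addr0.
Qed.

Let transE k : [/\ transition G (4 * k).+2 = if side k then - 1 else 1,
  transition G (4 * k).+3 = if side k then - 1 else 1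
  & transition G (4 * k).+4 = if side k then - 1 else 1].
Proof.
have [l3 l4 _] := leftE k.
have [_ ->] := transition_neq0 (h2 k); have [_ ->] := transition_neq0 (h3 k).
by have [_ ->] := transition_neq0 (h4 k); rewrite l3 l4.
Qed.

Let segment_fst j p : segment G j%:Z p ->
  exists s, [/\ 0 <= s, s <= 1 & p.1 = x j + s * (x j.+1 - x j)].
Proof.
case: (cs) => cl _ _ _ [s [s_ge s_le ->]]; move: s_ge s_le.
rewrite /first_halfline /last_halfline cl /= => -[//|s0] [//|s1].
by exists s; split=> //; rewrite /x (_ : j.+1%:Z = j%:Z + 1) //; lia.
Qed.

Let segment_in k p : [/\ segment G (4 * k).+1 p -> p.1 = 0,
  segment G (4 * k).+2 p -> exists2 s, 0 <= s <= 1 & p.1 = s * (sigma k * width),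
  segment G (4 * k).+3 p -> p.1 = sigma k * width
  & segment G (4 * k).+4 p -> exists2 s, 0 <= s <= 1 & p.1 = s * (sigma k * width)].
Proof.
have [e2 e3 e4 e5] := xE k; have [l2 l4] := len_even k.
have e5' : x (4 * k).+1.+4 = 0.
  by rewrite (_ : (4 * k).+1.+4 = (4 * k.+1).+1)%N ?x_axis //; lia.
rewrite x_axis l2 add0r in e2 e3 e4.
split=> /segment_fst[s [s0 s1 ->]].
- by rewrite e2 x_axis subrr mulr0 addr0.
- by exists s; rewrite ?s0 ?s1 // e2 e3 subr0 add0r.
- by rewrite e3 e4 subrr mulr0 addr0.
- by exists (1 - s); [lra | rewrite e4 e5'; ring].
Qed.

Lemma closed_double_right_angles :
  exists m, (1 <= m)%N /\ closed_double_right_angle_chain alpha m G.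
Proof.
have /dvdnP[N nE] : (4 %| nseg G)%N.
  by rewrite -cE -add1n (closed_period_transition cs) c1.
have N_even : odd N = false.
  have : transition G (4 * N).+2 = transition G 2.
    by rewrite -(closed_period_transition cs 2); congr (transition G _); lia.
  have [-> _ _] := transE N; have [-> _ _] := transE 0.
  by rewrite !sideE /=; case: (odd N); case: (left_turn G 2).
have [m Nm] : exists m, N = (2 * m)%N by exists (N./2); lia.
have nm : nseg G = (8 * m)%N by lia.
have m_gt0 : (0 < m)%N by case: cs; lia.
have e0 k : (4 * k + 2)%N%:Z - 1 = (4 * k).+1 by lia.
have e1 k : (4 * k + 2)%N%:Z + 1 = (4 * k).+3 by lia.
have e2 k : (4 * k + 2)%N%:Z + 2 = (4 * k).+4 by lia.
have e3 k : (4 * k + 2)%N%:Z + 3 = (4 * k.+1).+1 by lia.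
have eE (j : nat) : edge G j = scale (len G j) (tangent G j).
  exact/edgeE/(closed_len_gt0 cs).
have sw k : sigma k * width = - width \/ sigma k * width = width.
  by rewrite /sigma; case: (side k); [left; rewrite mulN1r | right; rewrite mul1r].
have decomp i : in_range G i -> exists k, [\/ i = (4 * k).+1, i = (4 * k).+2,
    i = (4 * k).+3 | i = (4 * k).+4].
  rewrite /in_range => ir; exists ((absz i).-1 %/ 4)%N.
  have : ((absz i).-1 %% 4 < 4)%N by rewrite ltn_mod.
  have := divn_eq (absz i).-1 4; move: (_ %/ _)%N (_ %% _)%N => q r qr r4.
  have : [\/ r = 0, r = 1, r = 2 | r = 3]%N.
    by case: r r4 {qr} => [|[|[|[|]]]] // _;
      [apply: Or41|apply: Or42|apply: Or43|apply: Or44].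
  by case=> rE; [apply: Or41|apply: Or42|apply: Or43|apply: Or44]; lia.
exists m; split=> //; split=> //.
- move=> k _; rewrite /opposite_transition !addn1 !addn2 addn3.
  have [d2 d3 d4] := transE k; have [d2' _ _] := transE k.+1.
  have [t1 t2 t3 t4] := tangentE k.
  split.
  + rewrite -addn2; split; rewrite ?e0 ?e1 ?e2 ?e3 ?h1 //.
    * by rewrite addn2 d2 d3; case: (side k).
    * by rewrite d3 d4; case: (side k).
    * rewrite /horizontal /vertical addn2 !eE t2 t3 t4 !scale_fst !scale_snd /=.
      by rewrite !mulr0.
  + apply: len_weight; first exact: closed_len_gt0 cs _.
      rewrite wE /pat4.
      have : ((4 * k).+2 %% 8 == 2)%N || ((4 * k).+2 %% 8 == 6)%N by lia.
      by case/orP => /eqP->.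
    by rewrite mulf_neq0 ?pnatr_eq0 // lt0r_neq0.
  + by rewrite d2 d2' !sideE oddS; case: (odd k); case: (left_turn G 2).
  + by split; rewrite /phi_curvature h1 // mulr0 mul0r; case: ifP.
- move=> [//|k] _; have [l2 l4] := len_even (k %/ 2).
  have : (2 * k.+1 = (4 * (k %/ 2)).+2)%N \/ (2 * k.+1 = (4 * (k %/ 2)).+4)%N by lia.
  by case=> ->.
- split.
  + move=> p [i [/decomp[k ik] ip]]; rewrite /in_vertical_strip /=.
    have [p1 p2 p3 p4] := segment_in k p; have w0 := width_gt0.
    case: ik ip => -> ip.
    * by rewrite (p1 ip) -/width; lra.
    * have [s s01 ->] := p2 ip; rewrite -/width.
      by case: (sw k) => ->; nra.
    * by rewrite (p3 ip) -/width; case: (sw k) => ->; lra.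
    * have [s s01 ->] := p4 ip; rewrite -/width.
      by case: (sw k) => ->; nra.
  + move=> i /decomp[k ik] iv p ip /=; rewrite -/width.
    have [p1 _ p3 _] := segment_in k p; have [t1 t2 t3 t4] := tangentE k.
    have [_ d3 _] := transE k; have [l2 l4] := len_even k; have w0 := width_gt0.
    case: ik iv ip => -> iv ip.
    * by rewrite (p1 ip) h1 mul0r.
    * exfalso; move: iv; rewrite /vertical eE t2 l2 scale_fst /= mulrC.
      by case: (sw k) => ->; lra.
    * by rewrite (p3 ip) d3 /sigma; case: (side k); rewrite ?mulrN1z ?mulr1z.
    * exfalso; move: iv; rewrite /vertical eE t4 l4 scale_fst /= mulrC mulNr.
      by case: (sw k) => ->; lra.
(* The double-right-angles turning left have [sigma] equal to -1 and lie in the left half. They are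
   the odd or the even ones, depending on the first turn, and [m] in number either way. *)
- exists [set k : 'I_(2 * m) | side k]%SET; split.
    case s0: (left_turn G 2).
      rewrite (_ : [set k : 'I_(2 * m) | side k]%SET = (~: [set k : 'I_(2 * m) | odd k])%SET).
        have := cardsC [set k : 'I_(2 * m) | odd k]%SET.
        by rewrite card_odd_ord card_ord => h; apply: (@addnI m); rewrite h; lia.
      by apply/setP => k; rewrite !inE sideE s0 addbT.
    rewrite -[RHS]card_odd_ord; congr #|pred_of_set _|.
    by apply/setP => k; rewrite !inE sideE s0 addbF.
  move=> k p; rewrite inE /double_right_angle_set e1 e2 addn2 => hp.
  have [_ p2 p3 p4] := segment_in k p; have w0 := width_gt0.
  have [s s01 pE] : exists2 s, 0 <= s <= 1 & p.1 = s * (sigma k * width).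
    case: hp => [[/p2//|/p3 ->]|/p4//].
    by exists 1; [rewrite ler01 lexx | rewrite mul1r].
  rewrite /in_vertical_strip; move: pE; rewrite /sigma.
  by case: (side k) => /= ->; rewrite -/width; nra.
Qed.

End ClosedDoubleRightAngles.

(** * Classification of the closed curves *)

Section ClosedClassification.
Variables (R : realType) (alpha : R) (G : polycurve R).
Hypotheses (alpha_gt0 : 0 < alpha) (cl : closed_curve G).
Hypotheses (adm : admissible G) (stat : stationary alpha G).

(** A zero segment followed by a nonzero one is moved to index 0 for right-angle chains, whose zero
    segments are the [S_(3k)], and to index 1 for double-right-angle chains, where they are the
    [S_(4k+1)]. *)
Lemma closed_classification :
  exists (f : R * R -> R * R) (k : int), motion f /\
    [\/ exists m : nat, (1 <= m)%N /\
          closed_right_angle_chain alpha m (move f (relabel k G)),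
        exists m : nat, (1 <= m)%N /\
          closed_double_right_angle_chain alpha m (move f (relabel k G))
      | square alpha (move f (relabel k G))].
Proof.
have cs := closed_stationaryP cl adm stat.
have [c_neq0|[j [c0 c1]]] := closed_trichotomy alpha_gt0 cs.
  exists id, 0; split; first exact: motion_id.
  rewrite move_id; apply: Or33; apply: closed_square => //.
    exact: closed_stationary_relabel.
  by move=> i; rewrite (transition_relabel cs).
have [w3|w3] := eqVneq (weight G (j + 3)) 0.
  exists id, j; split; first exact: motion_id.
  rewrite move_id; apply: Or31; apply: closed_right_angles => //.
  - exact: closed_stationary_relabel.
  - by rewrite (transition_relabel cs) add0r.
  - by rewrite (transition_relabel cs) addrC.
  - by rewrite (weight_relabel cs) addrC.
have csr := closed_stationary_relabel cs (j - 1).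
have [f [mf csf cE wE [T1 x1]]] := normalize_closed csr.
exists f, (j - 1); split=> //; apply: Or32; apply: closed_double_right_angles => //.
- by rewrite cE (transition_relabel cs) addrC subrK.
- by rewrite cE (transition_relabel cs) (_ : 2 + (j - 1) = j + 1) //; lia.
- by rewrite wE (weight_relabel cs) (_ : 4 + (j - 1) = j + 3) //; lia.
Qed.

End ClosedClassification.

(** * Polygonal curves with prescribed turns and lengths *)

Section Construction.
Variables (R : realType) (T0 : R * R) (l : nat -> R) (b : nat -> bool).

(** [b k] is the turn at the corner between [S_(k-1)] and [S_k], and [l k] the length of [S_k]. *)
Fixpoint direction (k : nat) : R * R :=
  if k is j.+1 then turn (b k) (direction j) else T0.

Fixpoint corner_point (k : nat) : R * R :=
  if k is j.+1 then corner_point j + scale (l j) (direction j) else 0.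

(* The points of negative index are irrelevant. *)
Definition unbounded_polyline n : polycurve R :=
  PolyCurve false n (fun i => corner_point (absz i)).

(** Reducing the index makes the vertices periodic by definition. They are the corner points at all
    natural indices once these are [n]-periodic, which is where closing enters. *)
Definition closed_polyline n : polycurve R :=
  PolyCurve true n (fun i => corner_point (absz (i %% n%:Z)%Z)).

Hypotheses (T0_axis : axis T0) (l_gt0 : forall k, 0 < l k).

Lemma direction_axis k : axis (direction k).
Proof. by elim: k => [//|k IH]; apply: axis_turn. Qed.

Section EdgeDescription.
Variable G : polycurve R.
Hypothesis edge_nat : forall k : nat, edge G k = scale (l k) (direction k).

Lemma len_nat (k : nat) : len G k = l k.
Proof.
by rewrite /len edge_nat enormZ ?ltW //; apply/axis_unit/direction_axis.
Qed.

Lemma tangent_nat (k : nat) : tangent G k = direction k.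
Proof.
by rewrite /tangent len_nat edge_nat scaleA mulVf ?scale1v ?lt0r_neq0.
Qed.

Lemma left_turn_nat (k : nat) : left_turn G k.+1 = b k.+1.
Proof.
have e : k.+1%:Z - 1 = k by lia.
apply: left_turn_turn; rewrite e !tangent_nat //.
exact/axis_unit/direction_axis.
Qed.

Let in_range_nat i : in_range G i -> exists k : nat, i = k.+1.
Proof. by rewrite /in_range => h; exists (absz i).-1; lia. Qed.

Lemma vtx_neq_nat i : in_range G i -> vtx G (i + 1) != vtx G i.
Proof.
move=> /in_range_nat[k ->]; rewrite -subr_eq0 -/(edge G k.+1); apply/eqP => e.
have := len_nat k.+1; rewrite /len e /enorm /dot /= mulr0 addr0 sqrtr0 => h.
by have := l_gt0 k.+1; rewrite -h ltxx.
Qed.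

Lemma admissible_nat : admissible G.
Proof.
split=> i.
  move=> /in_range_nat[k ->]; rewrite /normal tangent_nat.
  exact/axis_rot90/direction_axis.
move=> /andP[/in_range_nat[k ->] _].
by rewrite (_ : k.+1%:Z - 1 = k) ?tangent_nat ?dot_turn //; lia.
Qed.

Lemma weight_nat (k : nat) : weight G k.+1 =
  if halfline G k.+1 then 0
  else if b k.+1 == b k.+2 then (l k.+1 ^+ 2)^-1 else 0.
Proof.
rewrite /weight transitionE len_nat (_ : k.+1%:Z + 1 = k.+2); last by lia.
rewrite !left_turn_nat; case: halfline; first by rewrite expr0n mul0r.
case: eqP; last by rewrite expr0n mul0r.
by case: (b k.+1) => _; rewrite ?mulrN1z ?mulr1z ?sqrrN expr1n mul1r.
Qed.

Lemma stationary_nat alpha : 0 < alpha ->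
  (forall k : nat, in_range G k.+1 -> ~~ halfline G k.+1 ->
     weight G k.+2 = step (2 * alpha)^-1 (weight G k) (weight G k.+1)) ->
  stationary alpha G.
Proof.
move=> alpha_gt0 h i ir; have [k iE] := in_range_nat ir; move: ir; rewrite iE => ir hl.
apply/(stationary_atP alpha_gt0 hl).
rewrite (_ : k.+1%:Z + 1 = k.+2) 1?(_ : k.+1%:Z - 1 = k) ?h //; try lia.
by rewrite /step weight_eq0 // len_nat.
Qed.

End EdgeDescription.

Section UnboundedPolyline.
Variable n : nat.
Let G := unbounded_polyline n.

Lemma edge_unbounded_polyline (k : nat) : edge G k = scale (l k) (direction k).
Proof.
rewrite /edge (_ : k%:Z + 1 = k.+1); last by lia.
by rewrite /= addrAC subrr add0r.
Qed.

Lemma unbounded_curve_polyline : (2 <= n)%N -> unbounded_curve G.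
Proof. by move=> n2; split=> // i; apply: (vtx_neq_nat edge_unbounded_polyline). Qed.

Lemma admissible_unbounded_polyline : admissible G.
Proof. exact: admissible_nat edge_unbounded_polyline. Qed.

Lemma weight_unbounded_polyline (k : nat) : (k < n)%N -> weight G k.+1 =
  if (k == 0) || (k == n.-1) then 0
  else if b k.+1 == b k.+2 then (l k.+1 ^+ 2)^-1 else 0.
Proof.
move=> kn; rewrite (weight_nat edge_unbounded_polyline).
congr (if _ then _ else _).
by rewrite /halfline /first_halfline /last_halfline /=; lia.
Qed.

Lemma stationary_unbounded_polyline alpha (w : nat -> R) : 0 < alpha ->
  (forall k, w k.+2 = step (2 * alpha)^-1 (w k) (w k.+1)) ->
  (forall k : nat, (k < n)%N -> weight G k.+1 = w k) -> stationary alpha G.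
Proof.
move=> alpha_gt0 hw wE; apply: (stationary_nat edge_unbounded_polyline alpha_gt0).
move=> [|k] ir; rewrite /halfline /first_halfline /last_halfline //=.
move: ir; rewrite /in_range /= => ir hl.
by rewrite !wE ?hw //; lia.
Qed.

End UnboundedPolyline.

Section ClosedPolyline.
Variable n : nat.
Hypothesis period : forall k, corner_point (k + n)%N = corner_point k.
Let G := closed_polyline n.

Lemma vtx_closed_polyline (k : nat) : vtx G k = corner_point k.
Proof.
rewrite /= modz_nat /=; have := divn_eq k n; move: (k %/ n)%N (k %% n)%N => q r ->.
by elim: q => [|q IH]; rewrite ?mul0n ?add0n // mulSn -addnA addnC period.
Qed.

Lemma edge_closed_polyline (k : nat) : edge G k = scale (l k) (direction k).
Proof.
rewrite /edge (_ : k%:Z + 1 = k.+1) ?vtx_closed_polyline; last by lia.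
by rewrite /= addrAC subrr add0r.
Qed.

Lemma closed_curve_polyline : (0 < n)%N -> closed_curve G.
Proof.
move=> n_gt0; split=> // i; last exact: (vtx_neq_nat edge_closed_polyline).
by rewrite /= modzDr.
Qed.

Lemma admissible_closed_polyline : admissible G.
Proof. exact: admissible_nat edge_closed_polyline. Qed.

Lemma weight_closed_polyline (k : nat) : weight G k.+1 =
  if b k.+1 == b k.+2 then (l k.+1 ^+ 2)^-1 else 0.
Proof. exact: weight_nat edge_closed_polyline _. Qed.

(** The turn at index 0 involves the edge of index -1, outside the description of the edges;
    periodicity replaces it. *)
Lemma weight0_closed_polyline : (0 < n)%N -> weight G 0 = weight G n.
Proof.
move=> /closed_curve_polyline[cl _ per _].
by rewrite -(weight_periodic 1 cl per 0) mul1r add0r.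
Qed.

Lemma stationary_closed_polyline alpha (w : nat -> R) : 0 < alpha ->
  (forall k, w k.+2 = step (2 * alpha)^-1 (w k) (w k.+1)) ->
  (forall k : nat, weight G k = w k) -> stationary alpha G.
Proof.
move=> alpha_gt0 hw wE; apply: (stationary_nat edge_closed_polyline alpha_gt0).
by move=> k _ _; rewrite !wE hw.
Qed.

End ClosedPolyline.
End Construction.

Lemma axis_e1 (R : realType) : axis (@e1 R).
Proof. exact: Or41. Qed.

(* The turns of the chains are constant on blocks of three, resp. four, corners
   and alternate from one block to the next. *)
Lemma odd_div3_succ k :
  (odd ((k + 2) %/ 3) == odd ((k + 3) %/ 3)) = ~~ (3 %| k)%N.
Proof.
case: (boolP (3 %| k)%N) => h.
- have -> : ((k + 3) %/ 3 = ((k + 2) %/ 3).+1)%N by lia.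
  by rewrite oddS; case: odd.
- have -> : ((k + 3) %/ 3 = (k + 2) %/ 3)%N by lia.
  by rewrite eqxx.
Qed.

Lemma odd_div4_succ k :
  (odd ((k + 3) %/ 4) == odd ((k + 4) %/ 4)) = ~~ (4 %| k)%N.
Proof.
case: (boolP (4 %| k)%N) => h.
- have -> : ((k + 4) %/ 4 = ((k + 3) %/ 4).+1)%N by lia.
  by rewrite oddS; case: odd.
- have -> : ((k + 4) %/ 4 = (k + 3) %/ 4)%N by lia.
  by rewrite eqxx.
Qed.

(** * Existence of staircases and chains with prescribed free lengths *)

Section Existence.
Variables (R : realType) (alpha : R).
Hypothesis alpha_gt0 : 0 < alpha.
Let K : R := (2 * alpha)^-1.
Let side : R := Num.sqrt (2 * alpha).

Let K_neq0 : K != 0.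
Proof. by rewrite invr_neq0 // mulf_neq0 // lt0r_neq0. Qed.

Let side_gt0 : 0 < side.
Proof. by rewrite sqrtr_gt0 mulr_gt0. Qed.

Let sideV : (side ^+ 2)^-1 = K.
Proof. by rewrite sqr_sqrtr // mulr_ge0 // ltW. Qed.

Lemma staircase_exists (n : nat) (l : nat -> R) : (2 <= n)%N ->
  (forall i : nat, (1 < i < n)%N -> 0 < l i) ->
  exists G : polycurve R,
    [/\ unbounded_curve G, admissible G, stationary alpha G
      & [/\ nseg G = n, staircase G
          & forall i : nat, (1 < i < n)%N -> len G i = l i]].
Proof.
(* The value 1 gives the half-lines a direction. *)
move=> n2 l0; pose l' (i : nat) : R := if (1 < i < n)%N then l i else 1.
have l'0 i : 0 < l' i by rewrite /l'; case: ifP => // /l0.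
have ax := @axis_e1 R.
have wE k : (k < n)%N -> weight (unbounded_polyline e1 l' odd n) k.+1 = 0.
  move=> kn; rewrite weight_unbounded_polyline //; case: ifP => // _.
  by rewrite [odd k.+2]oddS; case: (odd k.+1).
have unb := @unbounded_curve_polyline _ _ l' odd ax l'0 n n2.
have st : stationary alpha (unbounded_polyline e1 l' odd n).
  apply: (@stationary_unbounded_polyline _ _ _ _ ax l'0 _ _ (fun=> 0)) => //.
  by move=> k; rewrite /step eqxx.
have adm := @admissible_unbounded_polyline _ _ l' odd ax l'0 n.
exists (unbounded_polyline e1 l' odd n); split=> //; split=> //.
- by apply: (unbounded_staircase alpha_gt0) => //; apply: (wE 1%N).
- move=> i h; rewrite (len_nat ax l'0 (edge_unbounded_polyline e1 l' odd n)).
  by rewrite /l' h.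
Qed.

Lemma right_angle_chain_exists (m : nat) (l : nat -> R) : (1 <= m)%N ->
  (forall k : nat, (0 < k < m)%N -> 0 < l k) ->
  exists G : polycurve R,
    [/\ unbounded_curve G, admissible G, stationary alpha G
      & right_angle_chain alpha m G /\
        forall k : nat, (0 < k < m)%N -> len G (3 * k + 1)%N = l k].
Proof.
move=> m1 l0; pose n := (3 * m + 1)%N.
pose l' (i : nat) : R := if (i %% 3 == 1)%N
  then (if (0 < i %/ 3 < m)%N then l (i %/ 3)%N else 1) else side.
(* The offset puts the corners 2, 3, 4 of the first right-angle into one block. *)
pose b (i : nat) := odd ((i + 1) %/ 3).
have l'0 i : 0 < l' i by rewrite /l'; case: ifP => // _; case: ifP => // /l0.
have ax := @axis_e1 R; have n2 : (2 <= n)%N by rewrite /n; lia.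
set G := unbounded_polyline e1 l' b n.
have wE k : (k < n)%N -> weight G k.+1 = pat3 K k.
  move=> kn; rewrite weight_unbounded_polyline // /pat3 /b.
  rewrite (_ : k.+1 + 1 = k + 2)%N; last by lia.
  rewrite (_ : k.+2 + 1 = k + 3)%N ?odd_div3_succ ?if_neg; last by lia.
  have [k3|k3] := boolP (3 %| k)%N; first by case: ifP.
  rewrite ifF; last by rewrite /n in kn *; lia.
  by rewrite /l' ifF ?sideV //; lia.
have unb := @unbounded_curve_polyline _ _ l' b ax l'0 n n2.
have st : stationary alpha G.
  apply: (@stationary_unbounded_polyline _ _ _ _ ax l'0 _ _ (pat3 K)) => //.
  by move=> k; apply: pat3_step.
have adm := @admissible_unbounded_polyline _ _ l' b ax l'0 n.
exists G; split=> //; split.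
- have [||m' [_ ch]] := unbounded_right_angles alpha_gt0 unb st.
  + by rewrite (wE 1%N) //; rewrite /n; lia.
  + by rewrite (wE 3%N) //; rewrite /n; lia.
  (* The classification yields a chain of some [m'] right-angles; counting segments gives
     [m' = m]. *)
  + by case: (ch) => nE _ _ _; have <- : m' = m by move: nE; rewrite /= /n; lia.
- move=> k km; rewrite (len_nat ax l'0 (edge_unbounded_polyline e1 l' b n)).
  rewrite /l' (_ : (3 * k + 1) %% 3 = 1)%N; last by lia.
  by rewrite (_ : (3 * k + 1) %/ 3 = k)%N ?km //; lia.
Qed.

Lemma double_right_angle_chain_exists (m : nat) (a c : R) (l : nat -> R) :
  (1 <= m)%N -> 0 < a -> 0 < c ->
  1 / a ^+ 2 + 1 / c ^+ 2 = 1 / (2 * alpha) ->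
  (forall k : nat, (0 < k < m)%N -> 0 < l k) ->
  exists G : polycurve R,
    [/\ unbounded_curve G, admissible G, stationary alpha G
      & double_right_angle_chain alpha a c m G /\
        forall k : nat, (0 < k < m)%N -> len G (4 * k + 1)%N = l k].
Proof.
move=> m1 a0 c0 ac l0; pose n := (4 * m + 1)%N.
(* Listed by the residue of the segment number modulo 8: [a] at 0 and 2, [c] at 4 and 6, vertical
   sides at 3 and 7, free lengths at 1 and 5. *)
pose l' (i : nat) : R :=
  nth 1 [:: a; if (0 < i %/ 4 < m)%N then l (i %/ 4)%N else 1; a; side; c;
            if (0 < i %/ 4 < m)%N then l (i %/ 4)%N else 1; c; side] (i %% 8).
pose b (i : nat) := odd ((i + 2) %/ 4).
have l'0 i : 0 < l' i.
  have h : 0 < (if (0 < i %/ 4 < m)%N then l (i %/ 4)%N else 1).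
    by case: ifP => // /l0.
  by rewrite /l'; case: (i %% 8)%N => [|[|[|[|[|[|[|[|k]]]]]]]] //=; rewrite nth_nil.
have ax := @axis_e1 R; have n2 : (2 <= n)%N by rewrite /n; lia.
set G := unbounded_polyline e1 l' b n.
pose A := (a ^+ 2)^-1.
have cA : (c ^+ 2)^-1 = K - A by move: ac; rewrite !div1r /K /A; lra.
have A0 : A != 0 by rewrite invr_neq0 // expf_neq0 // lt0r_neq0.
have B0 : K - A != 0 by rewrite -cA invr_neq0 // expf_neq0 // lt0r_neq0.
have wE k : (k < n)%N -> weight G k.+1 = pat4 K A k.
  move=> kn; rewrite weight_unbounded_polyline // /b.
  rewrite (_ : k.+1 + 2 = k + 3)%N; last by lia.
  rewrite (_ : k.+2 + 2 = k + 4)%N ?odd_div4_succ ?if_neg; last by lia.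
  have h : forall j, (k %% 8 = j)%N -> (4 %| k)%N = (4 %| j)%N by move=> j; lia.
  rewrite /pat4 /l' -[k.+1]addn1 -modnDml.
  have := ltn_pmod k (isT : (0 < 8)%N).
  case kE : (k %% 8)%N => [|[|[|[|[|[|[|[|j]]]]]]]] //= _; rewrite (h _ kE) /=;
    first [ by case: ifP
          | by rewrite ifF ?sideV ?cA //; rewrite /n in kn *; lia ].
have unb := @unbounded_curve_polyline _ _ l' b ax l'0 n n2.
have st : stationary alpha G.
  apply: (@stationary_unbounded_polyline _ _ _ _ ax l'0 _ _ (pat4 K A)) => //.
  by move=> k; apply: pat4_step.
have adm := @admissible_unbounded_polyline _ _ l' b ax l'0 n.
have lE (k : nat) : len G k = l' k.
  exact: (len_nat ax l'0 (edge_unbounded_polyline e1 l' b n)).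
exists G; split=> //; split.
- have [|||m' [_ _ _ _ ch]] := unbounded_double_right_angles alpha_gt0 unb adm st.
  + by rewrite (wE 1%N) //; rewrite /n; lia.
  + by rewrite (wE 3%N) //; rewrite /n; lia.
  + rewrite /horizontal edge_unbounded_polyline scale_snd /direction.
    by rewrite /turn; case: (b 1%N); case: (b 2%N); rewrite /= ?oppr0 ?mulr0.
  + rewrite !lE in ch.
    by case: (ch) => nE _ _ _ _; have <- : m' = m by move: nE; rewrite /= /n; lia.
- move=> k km; rewrite lE /l' (_ : (4 * k + 1) %/ 4 = k)%N; last by lia.
  rewrite km; have : ((4 * k + 1) %% 8 = 1)%N \/ ((4 * k + 1) %% 8 = 5)%N by lia.
  by case=> ->.
Qed.

Section ClosedRightAngleChains.
Variables (m : nat) (l : nat -> R).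
Hypothesis m_gt1 : (1 < m)%N.
(** What the closing condition in the direction of [S_(6m)] leaves for that segment. *)
Let L : R := 2 * m%:R * side - \sum_(1 <= k < 2 * m | ~~ odd k) l k.

Lemma closed_right_angle_chain_last G : closed_curve G -> admissible G ->
  stationary alpha G -> closed_right_angle_chain alpha m G ->
  (forall k : nat, (1 <= k < 2 * m)%N -> len G (3 * k)%N = l k) ->
  len G (6 * m)%N = L.
Proof.
move=> cl adm st [nE ra _ zc _] lE.
have cs := closed_stationaryP cl adm st.
have [k km|k km|S0 _] := @closed_right_angles_closing _ _ _ cs m side nE.
- have [[_ + _] _ _] := ra k km; have [_ c3] := zc k.+1 ltac:(lia).
  rewrite (_ : _ + 1 = (3 * k + 2)%N :> int); last by lia.
  move=> h; split.
  + by apply: contraTneq h => ->; rewrite mul0r ltxx.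
  + by apply: contraTneq h => ->; rewrite mulr0 ltxx.
  + by rewrite -c3; congr transition; lia.
- by have [_ -> ->] := ra k km.
rewrite -nE -[nseg G]add0n (closed_period_len cs) /L sum_even; last by lia.
have m0 : (0 < m)%N by lia.
rewrite -S0 (big_ltn m0) muln0.
rewrite [X in _ = _ + X - _](_ : _ = \sum_(1 <= k < m) l (2 * k)%N) ?addrK //.
apply: eq_big_nat => k km.
by rewrite -lE; [congr len; lia | lia].
Qed.

Hypothesis l_gt0 : forall k : nat, (1 <= k < 2 * m)%N -> 0 < l k.
Hypothesis l_odd : \sum_(1 <= k < 2 * m | odd k) l k = 2 * m%:R * side.
Hypothesis l_even : \sum_(1 <= k < 2 * m | ~~ odd k) l k < 2 * m%:R * side.

(** [l_odd] is one closing condition; the other is met by the choice of [L], which [l_even] makes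
    positive. *)
Lemma closed_right_angle_chain_exists : exists G : polycurve R,
  [/\ closed_curve G, admissible G, stationary alpha G
    & closed_right_angle_chain alpha m G /\
      forall k : nat, (1 <= k < 2 * m)%N -> len G (3 * k)%N = l k].
Proof.
pose n := (6 * m)%N; have n0 : (0 < n)%N by rewrite /n; lia.
(* The last segment [S_(6m)] appears as [S_0]; reducing the index modulo [n] below makes the lengths
   periodic. *)
pose l2 (k : nat) : R := if k == 0 then L else l k.
pose l' (i : nat) : R := if (3 %| i)%N then l2 ((i %% n) %/ 3)%N else side.
pose b (i : nat) := odd ((i + 2) %/ 3).
have L0 : 0 < L by rewrite subr_gt0.
have l'0 i : 0 < l' i.
  rewrite /l'; case: ifP => // _; rewrite /l2; case: ifP => // /eqP h; apply: l_gt0.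
  by have := ltn_pmod i n0; rewrite {2}/n; lia.
have ax := @axis_e1 R.
have bE k : b (k + 6)%N = b k.
  by rewrite /b (_ : (k + 6 + 2) %/ 3 = ((k + 2) %/ 3).+2)%N ?oddS ?negbK //; lia.
have d6 k : direction (@e1 R) b (k + 6)%N = direction e1 b k.
  elim: k => [|k IH]; first by rewrite /= /turn /b /= !(rot90N, rot90K, opprK).
  by rewrite addSn /= IH -addSn bE.
have dn k : direction (@e1 R) b (k + n)%N = direction e1 b k.
  by rewrite /n; elim: (m) => [|q IH]; rewrite ?addn0 // mulnSr addnA d6.
have l'n k : l' (k + n)%N = l' k.
  rewrite /l' modnDr; congr (if _ then _ else _).
  by rewrite dvdn_addl // /n; lia.
have l'E k : (k < 2 * m)%N -> l' (3 * k)%N = l2 k.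
  move=> km; rewrite /l' dvdn_mulr // modn_small; last by rewrite /n; lia.
  by rewrite mulKn.
have Pn : corner_point e1 l' b n = 0.
  apply/(@right_angle_chain_closing _ _ (direction (@e1 R) b) l' b side m) => //.
  - move=> k _; rewrite /b; split.
    + by rewrite (_ : (3 * k + 2 + 2) %/ 3 = (3 * k + 1 + 2) %/ 3)%N //; lia.
    + by rewrite (_ : (3 * k + 3 + 2) %/ 3 = (3 * k + 1 + 2) %/ 3)%N //; lia.
    + by rewrite (_ : (3 * k + 4 + 2) %/ 3 = ((3 * k + 1 + 2) %/ 3).+1)%N //; lia.
  - by move=> k _; rewrite /l' !ifF //; lia.
  - have m0 : (0 < m)%N by lia.
    split.
    + rewrite (big_ltn m0) muln0 (l'E 0%N) ?/l2 //=; last by lia.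
      rewrite [X in _ + X = _](_ : _ = \sum_(1 <= k < m) l (2 * k)%N).
        by rewrite /L sum_even // subrK.
      apply: eq_big_nat => k km.
      rewrite (_ : 6 * k = 3 * (2 * k))%N ?l'E /l2 ?ifF //; lia.
    + rewrite -l_odd sum_odd //; apply: eq_big_nat => k km.
      rewrite (_ : 6 * k + 3 = 3 * (2 * k + 1))%N ?l'E /l2 ?ifF //; lia.
have period k : corner_point e1 l' b (k + n)%N = corner_point e1 l' b k.
  by elim: k => [|k IH]; rewrite ?add0n // addSn /= IH l'n dn.
set G := closed_polyline e1 l' b n.
have cl : closed_curve G := closed_curve_polyline ax l'0 period n0.
have adm : admissible G := admissible_closed_polyline ax l'0 period.
have wS (k : nat) : weight G k.+1 = pat3 K k.+1.
  rewrite (weight_closed_polyline ax l'0 period) /b /pat3.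
  rewrite (_ : k.+2 + 2 = k.+1 + 3)%N ?odd_div3_succ ?if_neg; last by lia.
  by have [//|k3] := boolP (3 %| k.+1)%N; rewrite /l' (negbTE k3) sideV.
have wE (k : nat) : weight G k = pat3 K k.
  case: k => [|k]; last exact: wS.
  rewrite weight0_closed_polyline // -/G; have := wS n.-1; rewrite prednK // => ->.
  by rewrite /pat3 /n ifT //; lia.
have st : stationary alpha G.
  apply: (@stationary_closed_polyline _ _ _ _ ax l'0 _ period _ (pat3 K)) => //.
  by move=> k; apply: pat3_step.
have cs := closed_stationaryP cl adm st.
exists G; split=> //; split.
- have [|||m' [_ ch]] := closed_right_angles alpha_gt0 cs.
  + by apply/eqP; rewrite -(closed_weight_eq0 cs) (wE 0%N).
  + by rewrite -(closed_weight_eq0 cs) (wE 1%N).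
  + by rewrite (wE 3%N).
  + by case: (ch) => nE _ _ _ _; have <- : m' = m by move: nE; rewrite /= /n; lia.
- move=> k km; rewrite (len_nat ax l'0 (edge_closed_polyline period)).
  by rewrite l'E /l2 ?ifF //; lia.
Qed.

End ClosedRightAngleChains.
End Existence.

Theorem theorem8p1 (R : realType) (alpha : R) (alpha_gt0 : 0 < alpha) :
  [/\ (* unbounded case *)
      (forall G : polycurve R,
         unbounded_curve G -> admissible G -> stationary alpha G ->
         exists f : R * R -> R * R, motion f /\
           [\/ staircase (move f G),
               exists m : nat, (1 <= m)%N /\
                 right_angle_chain alpha m (move f G)
             | exists (m : nat) (a b : R),
                 [/\ (1 <= m)%N, 0 < a, 0 < b,
                     1 / a ^+ 2 + 1 / b ^+ 2 = 1 / (2 * alpha)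
                   & double_right_angle_chain alpha a b m (move f G)]]),
      (* closed case *)
      (forall G : polycurve R,
         closed_curve G -> admissible G -> stationary alpha G ->
         exists (f : R * R -> R * R) (k : int), motion f /\
           [\/ exists m : nat, (1 <= m)%N /\
                 closed_right_angle_chain alpha m (move f (relabel k G)),
               exists m : nat, (1 <= m)%N /\
                 closed_double_right_angle_chain alpha m (move f (relabel k G))
             | square alpha (move f (relabel k G))]),
      (* the lengths which can be chosen arbitrarily, unbounded case *)
      [/\ (forall (n : nat) (l : nat -> R), (2 <= n)%N ->
             (forall i : nat, (1 < i < n)%N -> 0 < l i) ->
             exists G : polycurve R,
               [/\ unbounded_curve G, admissible G, stationary alpha G
                 & [/\ nseg G = n, staircase G
                     & forall i : nat, (1 < i < n)%N -> len G i = l i]]),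
          (forall (m : nat) (l : nat -> R), (1 <= m)%N ->
             (forall k : nat, (0 < k < m)%N -> 0 < l k) ->
             exists G : polycurve R,
               [/\ unbounded_curve G, admissible G, stationary alpha G
                 & right_angle_chain alpha m G /\
                   forall k : nat, (0 < k < m)%N ->
                     len G (3 * k + 1)%N = l k])
        & (forall (m : nat) (a b : R) (l : nat -> R), (1 <= m)%N ->
             0 < a -> 0 < b ->
             1 / a ^+ 2 + 1 / b ^+ 2 = 1 / (2 * alpha) ->
             (forall k : nat, (0 < k < m)%N -> 0 < l k) ->
             exists G : polycurve R,
               [/\ unbounded_curve G, admissible G, stationary alpha G
                 & double_right_angle_chain alpha a b m G /\
                   forall k : nat, (0 < k < m)%N ->
                     len G (4 * k + 1)%N = l k])]
    & (* the lengths of the segments S_(3k), 1 <= k < 2m, of a closed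
         right-angle chain can be chosen arbitrarily, up to the two scalar
         conditions under which the curve closes up; S_(6m) is then uniquely
         determined *)
      forall (m : nat) (l : nat -> R), (1 < m)%N ->
        (forall k : nat, (1 <= k < 2 * m)%N -> 0 < l k) ->
        \sum_(1 <= k < 2 * m | odd k) l k = 2 * m%:R * Num.sqrt (2 * alpha) ->
        \sum_(1 <= k < 2 * m | ~~ odd k) l k < 2 * m%:R * Num.sqrt (2 * alpha) ->
        let chain := fun G : polycurve R =>
          [/\ closed_curve G, admissible G, stationary alpha G
            & closed_right_angle_chain alpha m G /\
              forall k : nat, (1 <= k < 2 * m)%N -> len G (3 * k)%N = l k] in
        (exists G : polycurve R, chain G) /\
        exists L : R, forall G : polycurve R, chain G -> len G (6 * m)%N = L].
Proof.
split.
- by move=> G; apply: unbounded_classification.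
- by move=> G; apply: closed_classification.
- split.
  + exact: staircase_exists.
  + exact: right_angle_chain_exists.
  + exact: double_right_angle_chain_exists.
- move=> m l m_gt1 l_gt0 l_odd l_even; split.
    exact: closed_right_angle_chain_exists.
  exists (2 * m%:R * Num.sqrt (2 * alpha) - \sum_(1 <= k < 2 * m | ~~ odd k) l k).
  move=> G [cl adm st [ch lE]].
  exact: (@closed_right_angle_chain_last _ alpha _ m l).
Qed.
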